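(* Let $\mu$ be a positive operator-valued measure on $\mathbb{T}$ satisfying the standing assumptions listed in the context, with $\mu_0=I$, let $n\ge0$, and let $$d\mu^{(n)}(\theta)=\big[\varphi_n^R(e^{i\theta})\varphi_n^R(e^{i\theta})^\dagger\big]^{-1}\frac{d\theta}{2\pi},$$ where $\varphi_n^R=\varphi_n^R(\cdot\,;d\mu)$. Then $\mu^{(n)}$ is normalized, i.e. $\mu^{(n)}(\mathbb{T})=I$; its right normalized orthogonal polynomials are $\varphi_j^R(z;d\mu^{(n)})=\varphi_j^R(z;d\mu)$ for $j=0,\dots,n$, and $$\varphi_j^R(z;d\mu^{(n)})=z^{j-n}\varphi_n^R(z;d\mu)\qquad\text{for } j>n.$$ The Verblunsky coefficients of $\mu^{(n)}$ are $$\alpha_j(d\mu^{(n)})=\begin{cases}\alpha_j(d\mu), & j\le n-1,\\ 0,& j\ge n.\end{cases}$$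
   Context: $\mathcal{H}$ is a separable complex Hilbert space, $\mathcal{L}(\mathcal{H})$ its bounded operators, $A^\dagger=A^*$ the adjoint, $\mathbb{T}$ the unit circle. An operator $A$ is positive definite if $\langle Ax,x\rangle>0$ for all $x\ne0$ and $A$ has a bounded inverse. A positive operator-valued measure is a map $\mu$ from the Borel sets of $\mathbb{T}$ to $\mathcal{L}(\mathcal{H})$ such that $\sigma\mapsto\langle\mu(\sigma)h,h\rangle$ is a positive Borel measure for every $h\in\mathcal{H}$. Its moments are $\mu_j=\int_{\mathbb{T}}e^{-ij\theta}\,d\mu(\theta)\in\mathcal{L}(\mathcal{H})$, $j\in\mathbb{Z}$, so $\mu_{-j}=\mu_j^*$. For $n\ge1$ the Toeplitz operator matrices on $\mathcal{H}^n$ are $T_n^R=[\mu_{j-k}]_{j,k=0}^{n-1}$ and $T_n^L=[\mu_{k-j}]_{j,k=0}^{n-1}$. Standing assumptions on $\mu$: $\mu$ is absolutely continuous, i.e. there is a weakly measurable $\mu':\mathbb{T}\to\mathcal{L}(\mathcal{H})$, $\mu'\ge0$ a.e., with $d\langle\mu(\theta)h,h\rangle=\langle\mu'(e^{i\theta})h,h\rangle\frac{d\theta}{2\pi}$ for all $h$; and $\mu$ is nontrivial, in the sense that $T_n^R$ and $T_n^L$ are positive definite (with bounded inverse) for all $n\ge1$. Put $\nu_n=(\mu_{-n},\dots,\mu_{-1})^{T}$ and $\xi_n=(\mu_n,\dots,\mu_1)^{T}$ (block columns, entries not adjointed), $\kappa_n^R=\mu_0-\nu_n^*(T_n^R)^{-1}\nu_n$,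 $\kappa_n^L=\mu_0-\xi_n^*(T_n^L)^{-1}\xi_n$, $\kappa_0^R=\kappa_0^L=\mu_0$; these are positive definite, $\kappa_n^{R/2},\kappa_n^{L/2}$ denote their positive definite square roots and $\kappa_n^{-R/2},\kappa_n^{-L/2}$ the inverses of these. The monic right orthogonal polynomials are $\Phi_0^R=I$ and $\Phi_n^R(z)=z^nI-[I\ \ zI\ \cdots\ z^{n-1}I](T_n^R)^{-1}\nu_n$ for $n\ge1$; the normalized ones are $\varphi_n^R=\Phi_n^R\kappa_n^{-R/2}$. The Verblunsky coefficients are $\alpha_n=-\kappa_n^{-R/2}\Phi_{n+1}^R(0)^\dagger\kappa_n^{L/2}$, $n\ge0$. The notations $\varphi_j^R(z;d\mu)$, $\alpha_j(d\mu)$ indicate the measure; the same definitions are applied to $\mu^{(n)}$. The operators $\varphi_n^R(z)$ are invertible for $z\in\mathbb{T}$, so $\mu^{(n)}$ is well defined. *)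

(* Defs.v *)
From HB Require Import structures.
From mathcomp Require Import all_boot all_order all_algebra.
From mathcomp Require Import complex.
From mathcomp Require Import all_classical all_reals all_analysis.
Set Implicit Arguments.
Unset Strict Implicit.
Unset Printing Implicit Defensive.
Import Order.TTheory GRing.Theory Num.Theory.
Import numFieldNormedType.Exports.
Local Open Scope classical_set_scope.
Local Open Scope ring_scope.
Local Open Scope complex_scope.

(* The form is linear in its first argument and conjugate-linear in the
   second; completeness is that of completeNormedModType.  H = 0 is allowed. *)
Record hilbertSpace (R : realType) := HilbertSpace {
  hcarrier :> completeNormedModType R[i];
  hdot : {dot hcarrier for @Num.conj R[i]};
  hdotE : forall x : hcarrier, hdot x x = `|x| ^+ 2;
  hseparable : exists2 D : set hcarrier, countable D & dense D }.

Notation "''[' x , y ]" := (@hdot _ _ x y) : ring_scope.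

Section BoundedOperators.
Variables (R : realType) (H : hilbertSpace R).

Record bop := Bop {
  bop_fun :> H -> H;
  bop_linear : linear bop_fun;
  bop_bounded : exists M : R[i], forall x, `|bop_fun x| <= M * `|x| }.

HB.instance Definition _ (A : bop) :=
  GRing.isLinear.Build _ _ _ _ (bop_fun A) (@bop_linear A).

Lemma bop_ext (A B : bop) : (forall x, A x = B x) -> A = B.
Proof.
case: A => a la ba; case: B => b lb bb /= /funext ab; subst b.
by congr Bop; exact: Prop_irrelevance.
Qed.

Lemma bop_zero_proof : linear (fun _ : H => 0 : H) /\
  exists M : R[i], forall x : H, `|0 : H| <= M * `|x|.
Proof.
split; first by move=> a x y; rewrite scaler0 addr0.
by exists 0 => x; rewrite normr0 mul0r.
Qed.

Lemma bop_one_proof : linear (fun x : H => x) /\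
  exists M : R[i], forall x : H, `|x| <= M * `|x|.
Proof. by split=> //; exists 1 => x; rewrite mul1r. Qed.

Lemma bop_opp_proof (A : bop) : linear (fun x => - A x) /\
  exists M : R[i], forall x, `|- A x| <= M * `|x|.
Proof.
split; first by move=> a x y; rewrite linearP opprD scalerN.
by have [M AM] := bop_bounded A; exists M => x; rewrite normrN.
Qed.

Lemma bop_add_proof (A B : bop) : linear (fun x => A x + B x) /\
  exists M : R[i], forall x, `|A x + B x| <= M * `|x|.
Proof.
split; first by move=> a x y; rewrite !linearP scalerDr addrACA.
have [M AM] := bop_bounded A; have [N BN] := bop_bounded B.
exists (M + N) => x; rewrite mulrDl.
by apply: le_trans (ler_normD _ _) _; apply: lerD.
Qed.

Lemma bop_scale_proof (c : R[i]) (A : bop) : linear (fun x => c *: A x) /\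
  exists M : R[i], forall x, `|c *: A x| <= M * `|x|.
Proof.
split.
  by move=> a x y; rewrite linearP scalerDr !scalerA mulrC.
have [M AM] := bop_bounded A.
by exists (`|c| * M) => x; rewrite normrZ -mulrA ler_wpM2l.
Qed.

Lemma bop_mul_proof (A B : bop) : linear (fun x => A (B x)) /\
  exists M : R[i], forall x, `|A (B x)| <= M * `|x|.
Proof.
split; first by move=> a x y; rewrite !linearP.
have [M AM] := bop_bounded A; have [N BN] := bop_bounded B.
exists (`|M| * N) => x.
have M0 y : `|A y| <= `|M| * `|y|.
  rewrite -[leRHS]ger0_norm ?mulr_ge0// normrM normr_id -normrM.
  by rewrite ger0_norm ?AM// (le_trans _ (AM y)).
by rewrite (le_trans (M0 _))// -mulrA ler_wpM2l.
Qed.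

Definition bop_zero := Bop bop_zero_proof.1 bop_zero_proof.2.
Definition bop_one := Bop bop_one_proof.1 bop_one_proof.2.
Definition bop_opp A := Bop (bop_opp_proof A).1 (bop_opp_proof A).2.
Definition bop_add A B := Bop (bop_add_proof A B).1 (bop_add_proof A B).2.
Definition bop_scale c A := Bop (bop_scale_proof c A).1 (bop_scale_proof c A).2.
Definition bop_mul A B := Bop (bop_mul_proof A B).1 (bop_mul_proof A B).2.

HB.instance Definition _ := gen_eqMixin bop.
HB.instance Definition _ := gen_choiceMixin bop.

Lemma bop_addA : associative bop_add.
Proof. by move=> A B C; apply: bop_ext => x /=; rewrite addrA. Qed.
Lemma bop_addC : commutative bop_add.
Proof. by move=> A B; apply: bop_ext => x /=; rewrite addrC. Qed.
Lemma bop_add0 : left_id bop_zero bop_add.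
Proof. by move=> A; apply: bop_ext => x /=; rewrite add0r. Qed.
Lemma bop_addN : left_inverse bop_zero bop_opp bop_add.
Proof. by move=> A; apply: bop_ext => x /=; rewrite addNr. Qed.
HB.instance Definition _ :=
  GRing.isZmodule.Build bop bop_addA bop_addC bop_add0 bop_addN.

Lemma bop_mulA : associative bop_mul.
Proof. by move=> A B C; apply: bop_ext. Qed.
Lemma bop_mul1 : left_id bop_one bop_mul.
Proof. by move=> A; apply: bop_ext. Qed.
Lemma bop_mulr1 : right_id bop_one bop_mul.
Proof. by move=> A; apply: bop_ext. Qed.
Lemma bop_mulDl : left_distributive bop_mul bop_add.
Proof. by move=> A B C; apply: bop_ext. Qed.
Lemma bop_mulDr : right_distributive bop_mul bop_add.
Proof. by move=> A B C; apply: bop_ext => x /=; rewrite linearD. Qed.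
HB.instance Definition _ := GRing.Zmodule_isPzRing.Build bop
  bop_mulA bop_mul1 bop_mulr1 bop_mulDl bop_mulDr.

Lemma bop_scaleA (a b : R[i]) (A : bop) :
  bop_scale a (bop_scale b A) = bop_scale (a * b) A.
Proof. by apply: bop_ext => x /=; rewrite scalerA. Qed.
Lemma bop_scale1 : left_id 1 bop_scale.
Proof. by move=> A; apply: bop_ext => x /=; rewrite scale1r. Qed.
Lemma bop_scaleDr : right_distributive bop_scale +%R.
Proof. by move=> c A B; apply: bop_ext => x /=; rewrite scalerDr. Qed.
Lemma bop_scaleDl (A : bop) : {morph bop_scale^~ A : a b / a + b}.
Proof. by move=> a b; apply: bop_ext => x /=; rewrite scalerDl. Qed.
HB.instance Definition _ := GRing.Zmodule_isLmodule.Build R[i] bop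
  bop_scaleA bop_scale1 bop_scaleDr bop_scaleDl.

End BoundedOperators.

(* Two-sided inverse in a possibly trivial, noncommutative ring; 0 if there is
   none. *)
Definition invertible (S : pzRingType) (a : S) : Prop :=
  exists b : S, a * b = 1 /\ b * a = 1.
Definition rinv (S : pzRingType) (a : S) : S :=
  xget 0 [set b : S | a * b = 1 /\ b * a = 1].

Section OperatorTheory.
Variables (R : realType) (H : hilbertSpace R).
Implicit Types A B : bop H.

(* By Riesz representation exactly one operator qualifies. *)
Definition adj A : bop H :=
  xget 0 [set B : bop H | forall x y, '[A x, y] = '[x, B y]].

(* The order of R[i] makes 0 <= z (resp. 0 < z) include "z is real". *)
Definition posop A : Prop := forall x, 0 <= '[A x, x].

Definition posdef A : Prop :=
  (forall x : H, x != 0 -> 0 < '[A x, x]) /\ invertible A.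

Definition opsqrt A : bop H := xget 0 [set B : bop H | posdef B /\ B * B = A].

(* L(H^n) is identified with the n x n matrices over L(H), so a bounded inverse
   on H^n is an inverse in the matrix ring. *)
Definition posdef_mx n (T : 'M[bop H]_n) : Prop :=
  (forall x : {ffun 'I_n -> H}, x != 0 ->
     0 < \sum_(j < n) '[\sum_(k < n) T j k (x k), x j]) /\
  invertible T.

Definition opmx_inv n (T : 'M[bop H]_n) : 'M[bop H]_n := rinv T.

End OperatorTheory.

Section Circle.
Variable R : realType.

(* R[i]^o is R[i] with its norm topology. *)
Definition unit_circle : set R[i]^o := [set z : R[i] | `|z| = 1].

Lemma expi_subproof (t : R) : unit_circle (cos t +i* sin t).
Proof. by rewrite /unit_circle /= normc_def /= cos2Dsin2 sqrtr1. Qed.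

Definition expi (t : R) : unit_circle := SigSub (mem_set (expi_subproof t)).

HB.instance Definition _ := isPointed.Build unit_circle (expi 0).

Definition circle : Type := g_sigma_algebraType (@open (set_type unit_circle)).
HB.instance Definition _ := Measurable.on circle.

Definition cval (z : circle) : R[i] := val z.

(* Integral over A against dtheta/2pi, the circle being parametrized by
   [0, 2pi). *)
Definition arc_integral (A : set circle) (f : circle -> R) : \bar R :=
  let D : set R := [set t | 0 <= t < pi *+ 2 /\ A (expi t)] in
  (((pi *+ 2)^-1)%R%:E * \int[lebesgue_measure]_(t in D) (f (expi t))%:E)%E.

End Circle.

Section Measures.
Variables (R : realType) (H : hilbertSpace R).
Implicit Types (mu : set (circle R) -> bop H) (w : circle R -> bop H) (h : H).

(* The scalar measure sigma |-> <mu(sigma) h, h>, which is_povm forces to be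
   real. *)
Definition quad_measure mu h : set (circle R) -> \bar R :=
  fun A => (complex.Re '[mu A h, h])%:E.

(* A POVM is a total function on sets; its values off the Borel sets are
   irrelevant. *)
Definition is_povm mu : Prop := forall h, exists m : {measure set (circle R) -> \bar R},
  forall A, measurable A ->
    m A \is a fin_num /\ '[mu A h, h] = (fine (m A))%:C.

Definition cintegral (m : set (circle R) -> \bar R) (f : circle R -> R[i]) : R[i] :=
  fine (\int[m]_z (complex.Re (f z))%:E) +i*
  fine (\int[m]_z (complex.Im (f z))%:E).

(* The operator mu_j is the weak integral of z^-j; by polarization its
   quadratic form determines it. *)
Definition moment mu (j : int) : bop H :=
  xget 0 [set B : bop H | forall h,
    '[B h, h] = cintegral (quad_measure mu h) (fun z => cval z ^ (- j))].

Definition weakly_measurable w : Prop := forall h g,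
  measurable_fun setT (fun z => complex.Re '[w z h, g]) /\
  measurable_fun setT (fun z => complex.Im '[w z h, g]).

Definition has_density mu w : Prop :=
  [/\ weakly_measurable w,
      {ae lebesgue_measure, forall t : R, posop (w (expi t))} &
      forall h (A : set (circle R)), measurable A ->
        quad_measure mu h A =
        arc_integral A (fun z => complex.Re '[w z h, h])].

Definition abs_continuous mu : Prop := exists w, has_density mu w.

Definition toepR mu n : 'M[bop H]_n :=
  \matrix_(j < n, k < n) moment mu (j%:Z - k%:Z).
Definition toepL mu n : 'M[bop H]_n :=
  \matrix_(j < n, k < n) moment mu (k%:Z - j%:Z).

Definition nontrivial mu : Prop := forall n, (1 <= n)%N ->
  posdef_mx (toepR mu n) /\ posdef_mx (toepL mu n).

Definition nuv mu n : 'cV[bop H]_n := \col_(k < n) moment mu (k%:Z - n%:Z).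
Definition xiv mu n : 'cV[bop H]_n := \col_(k < n) moment mu (n%:Z - k%:Z).

Definition adj_row n (v : 'cV[bop H]_n) : 'rV[bop H]_n :=
  \row_(k < n) adj (v k 0).

(* For n = 0 the matrix products below are empty sums, so that
   kappaR mu 0 = kappaL mu 0 = moment mu 0 and PhiR mu 0 z = 1. *)
Definition kappaR mu n : bop H :=
  moment mu 0 - (adj_row (nuv mu n) *m opmx_inv (toepR mu n) *m nuv mu n) 0 0.
Definition kappaL mu n : bop H :=
  moment mu 0 - (adj_row (xiv mu n) *m opmx_inv (toepL mu n) *m xiv mu n) 0 0.

Definition powers_row n (z : R[i]) : 'rV[bop H]_n := \row_(k < n) (z ^+ k *: (1 : bop H)).

Definition PhiR mu n (z : R[i]) : bop H :=
  z ^+ n *: (1 : bop H) -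
  (powers_row n z *m opmx_inv (toepR mu n) *m nuv mu n) 0 0.

Definition phiR mu n (z : R[i]) : bop H :=
  PhiR mu n z * rinv (opsqrt (kappaR mu n)).

Definition verblunsky mu n : bop H :=
  - (rinv (opsqrt (kappaR mu n)) * adj (PhiR mu n.+1 0) *
     opsqrt (kappaL mu n)).

Definition bs_density mu n : circle R -> bop H :=
  fun z => rinv (phiR mu n (cval z) * adj (phiR mu n (cval z))).

End Measures.

(* Main.v *)
Require Import Defs.
From HB Require Import structures.
From mathcomp Require Import all_boot all_order all_algebra.
From mathcomp Require Import complex.
From mathcomp Require Import all_classical all_reals all_analysis.
From mathcomp Require Import measurable_realfun.
From mathcomp Require Import ring lra zify.
Set Implicit Arguments.
Unset Strict Implicit.
Unset Printing Implicit Defensive.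
Import Order.TTheory GRing.Theory Num.Theory.
Import numFieldNormedType.Exports.
Local Open Scope classical_set_scope.
Local Open Scope ring_scope.

(** Write Phi for the monic polynomial Phi_n of mu, a_i for its coefficients and
    kappa for kappa_n. Only one property of Phi and kappa matters, and it is
    algebraic ([Phi_orth]):

      sum_i mu_(k-i) a_i = 0 for 0 <= k < n, and = kappa for k = n.       (1)

    Let g be a polynomial of degree at most n with coefficients in H, and let
    its energy be the Toeplitz form <T_(n+1) g, g>. By (1) Phi x is orthogonal
    to all polynomials of lower degree and has energy <kappa x, x>; since
    multiplication by z preserves the form, the step g |-> z (g - Phi g_n)
    lowers the energy by exactly <kappa g_n, g_n> ([tform_step]). Here kappa is
    bounded below because it is a Schur complement of an invertible positive
    matrix ([kappaR_coercive]), and n + 1 consecutive leading coefficients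
    determine g, so n + 1 steps shrink the energy by a factor less than 1
    ([energy_decay]). Two consequences replace the usual study of the zeros of
    Phi.

    - The remainders in the expansion of Phi(z)^-1 in powers of z^-1 are iterates
      of the step, so the expansion converges uniformly on the circle
      ([opoly_inverse]). Thus Phi(z) is invertible there, and its inverse starts
      with z^-n.

    - If two sequences of moments with nonnegative forms satisfy (1) with the
      same Phi and kappa, the difference of their forms is invariant under the
      step, hence 0: the moments of index at most n agree ([orth_tform_unique]).

    The density of mu^(n) is w = (Phi^-1)^* kappa Phi^-1 on the circle
    ([bs_densityE]), so w Phi = (Phi^-1)^* kappa, whose Fourier expansion starts
    with z^n kappa. Comparing coefficients, the moments of mu^(n) satisfy (1),
    with 0 on the right for all integers k < n ([bs_orth]). By the uniqueness
    above they agree with those of mu up to index n, which settles every claim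
    about indices up to n. The relations for k < 0 say that
    z^d Phi is orthogonal to 1, ..., z^(n+d-1), so that Phi_(n+d) = z^d Phi and
    kappa_(n+d) = kappa; since z^(d+1) Phi vanishes at 0, so do the Verblunsky
    coefficients from n on. Finally mu^(n) is nontrivial because w is bounded
    below ([bs_form_coercive], [coercive_mx_invertible]).

    Operators enter through their bounded sesquilinear forms ([riesz_sesq]), and
    limits of operators through geometric estimates on each vector
    ([bop_lim]); inverses and square roots of coercive operators come from
    rescaling them to 1 - B with B a strict contraction. *)

(** * Real-valued norms *)

(** The norms take values in R[i]; the inequalities of the proof live in R, where
    the order is total. *)
Definition nm (R : realType) (V : normedZmodType R[i]) (x : V) : R :=
  complex.Re `|x|.

Section RealNorm.
Variable R : realType.
Implicit Types (V : normedZmodType R[i]) (z : R[i]) (r : R).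

Lemma ge0_complexE z : 0 <= z -> z = (complex.Re z)%:C%C.
Proof. by move=> z0; rewrite RRe_real// ger0_real. Qed.

Lemma nmE V (x : V) : `|x| = (nm x)%:C%C.
Proof. exact: ge0_complexE. Qed.

Lemma nm_ge0 V (x : V) : 0 <= nm x.
Proof. by rewrite -lecR -nmE; exact: normr_ge0. Qed.

Lemma nm0 V : nm (0 : V) = 0.
Proof. by rewrite /nm normr0. Qed.

Lemma nm_eq0 V (x : V) : nm x = 0 -> x = 0.
Proof. by move=> x0; apply/eqP; rewrite -normr_eq0 nmE x0. Qed.

Lemma nmN V (x : V) : nm (- x) = nm x.
Proof. by rewrite /nm normrN. Qed.

Lemma nmD V (x y : V) : nm (x + y) <= nm x + nm y.
Proof. by have := ler_normD x y; rewrite !nmE -rmorphD lecR. Qed.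

Lemma nm_sum V (I : Type) (s : seq I) (P : pred I) (F : I -> V) :
  nm (\sum_(i <- s | P i) F i) <= \sum_(i <- s | P i) nm (F i).
Proof.
elim/big_ind2: _ => [|x u y v xu yv|i _]; rewrite ?nm0//.
by rewrite (le_trans (nmD _ _))// lerD.
Qed.

Lemma nmM z1 z2 : nm (z1 * z2) = nm z1 * nm z2.
Proof. by apply: complexI; rewrite rmorphM/= -!nmE; exact: normrM. Qed.

Lemma nmZ (V : normedModType R[i]) z (x : V) : nm (z *: x) = nm z * nm x.
Proof. by apply: complexI; rewrite rmorphM/= -!nmE; exact: normrZ. Qed.

Lemma nm_conj z : nm z^* = nm z.
Proof. by rewrite /nm norm_conjC. Qed.

Lemma nm1 : nm (1 : R[i]) = 1.
Proof. by rewrite /nm normr1. Qed.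

Lemma nmX z k : nm (z ^+ k) = nm z ^+ k.
Proof. by elim: k => [|k IH]; rewrite ?expr0 ?nm1// !exprS nmM IH. Qed.

Lemma nm_real r : nm (r%:C%C) = `|r|.
Proof. by rewrite /nm normc_def /= expr0n addr0 sqrtr_sqr. Qed.

Lemma nm_Re z : `|complex.Re z| <= nm z.
Proof.
rewrite /nm normc_def /= -(sqrtr_sqr (complex.Re z)).
by rewrite ler_wsqrtr// lerDl sqr_ge0.
Qed.

Lemma nm_Im z : `|complex.Im z| <= nm z.
Proof.
rewrite /nm normc_def /= -(sqrtr_sqr (complex.Im z)).
by rewrite ler_wsqrtr// lerDr sqr_ge0.
Qed.

Lemma nm_le_ReIm z : nm z <= `|complex.Re z| + `|complex.Im z|.
Proof.
rewrite [in leLHS](complexE z) (le_trans (nmD _ _))// nm_real nmM nm_real.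
by rewrite lerD2l -[leRHS]mul1r ler_wpM2r// /nm normc_def /= expr0n add0r expr1n sqrtr1.
Qed.

Lemma sqr_nm z : ((nm z) ^+ 2)%:C%C = z * z^*.
Proof. by rewrite rmorphXn /= -nmE -normCK. Qed.

Lemma conj_realC r : (r%:C%C)^* = r%:C%C :> R[i].
Proof. by rewrite conj_Creal//; apply/complex_realP; exists r. Qed.

End RealNorm.

(** * Sesquilinear forms and the inner product *)

Definition sesquilinear (R : realType) (U : lmodType R[i]) (s : U -> U -> R[i]) :=
  (forall a x y z, s (a *: x + y) z = a * s x z + s y z) /\
  (forall a x y z, s z (a *: x + y) = a^* * s z x + s z y).

Section Sesquilinear.
Variables (R : realType) (U : lmodType R[i]) (s : U -> U -> R[i]).
Hypothesis ss : sesquilinear s.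

Lemma sesqDl x y z : s (x + y) z = s x z + s y z.
Proof. by have := ss.1 1 x y z; rewrite scale1r mul1r. Qed.

Lemma sesqDr x y z : s z (x + y) = s z x + s z y.
Proof. by have := ss.2 1 x y z; rewrite scale1r conjC1 mul1r. Qed.

Lemma sesq0l z : s 0 z = 0.
Proof. by apply: (addrI (s 0 z)); rewrite -sesqDl !addr0. Qed.

Lemma sesq0r z : s z 0 = 0.
Proof. by apply: (addrI (s z 0)); rewrite -sesqDr !addr0. Qed.

Lemma sesqZl a x z : s (a *: x) z = a * s x z.
Proof. by have := ss.1 a x 0 z; rewrite addr0 sesq0l addr0. Qed.

Lemma sesqZr a x z : s z (a *: x) = a^* * s z x.
Proof. by have := ss.2 a x 0 z; rewrite addr0 sesq0r addr0. Qed.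

Lemma sesqNl x z : s (- x) z = - s x z.
Proof. by rewrite -scaleN1r sesqZl mulN1r. Qed.

Lemma sesqNr x z : s z (- x) = - s z x.
Proof. by rewrite -scaleN1r sesqZr rmorphN1 mulN1r. Qed.

Lemma sesqBl x y z : s (x - y) z = s x z - s y z.
Proof. by rewrite sesqDl sesqNl. Qed.

Lemma sesqBr x y z : s z (x - y) = s z x - s z y.
Proof. by rewrite sesqDr sesqNr. Qed.

(** Polarization: x + y and x + i y give the symmetric and the antisymmetric
    part. *)
Lemma sesq_polar0 : (forall x, s x x = 0) -> forall x y, s x y = 0.
Proof.
move=> s0 x y.
have E1 : s x y + s y x = 0.
  have := s0 (x + y); rewrite !(sesqDl, sesqDr) !s0 add0r addr0 => <-.
  by [].
have E2 : s y x - s x y = 0.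
  have := s0 (x + 'i *: y).
  rewrite !(sesqDl, sesqDr, sesqZl, sesqZr) !s0 !mulr0 add0r addr0 conjCi.
  by rewrite mulNr addrC -mulrBr => /eqP; rewrite mulf_eq0 (negbTE (neq0Ci _))/= => /eqP.
have : s x y *+ 2 = 0.
  rewrite mulr2n -[X in X + _](addrK (s y x)) E1 add0r.
  by rewrite addrC -opprB E2 oppr0.
by move=> /eqP; rewrite mulrn_eq0/= => /eqP.
Qed.


End Sesquilinear.

Lemma sesq_sub (R : realType) (U : lmodType R[i]) (s t : U -> U -> R[i]) :
  sesquilinear s -> sesquilinear t -> sesquilinear (fun x y => s x y - t x y).
Proof.
move=> [s1 s2] [t1 t2]; split=> a x y z; rewrite ?s1 ?t1 ?s2 ?t2 mulrBr; ring.
Qed.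

Lemma sesq_conj (R : realType) (U : lmodType R[i]) (s : U -> U -> R[i]) :
  sesquilinear s -> sesquilinear (fun x y => (s y x)^*).
Proof.
by move=> [s1 s2]; split=> a x y z; rewrite ?s1 ?s2 rmorphD rmorphM/= ?conjCK.
Qed.

Lemma sesq_polar (R : realType) (U : lmodType R[i]) (s t : U -> U -> R[i]) :
  sesquilinear s -> sesquilinear t -> (forall x, s x x = t x x) ->
  forall x y, s x y = t x y.
Proof.
move=> ss st e x y; apply/eqP; rewrite -subr_eq0; apply/eqP.
by apply: (sesq_polar0 (sesq_sub ss st)) => z; rewrite e subrr.
Qed.

Lemma sesq_herm (R : realType) (U : lmodType R[i]) (s : U -> U -> R[i]) :
  sesquilinear s -> (forall x, s x x \is Num.real) ->
  forall x y, s y x = (s x y)^*.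
Proof.
move=> ss sr x y; apply: (sesq_polar ss (sesq_conj ss)) => z.
by rewrite conj_Creal.
Qed.

Section Psd.
Variables (R : realType) (U : lmodType R[i]) (s : U -> U -> R[i]).
Hypotheses (ss : sesquilinear s) (s0 : forall x, 0 <= s x x).

(** Nonnegativity at x - r s(x,y) y for all real r; a degenerate s y y = 0 is
    excluded by taking r large. *)
Lemma psd_CauchySchwarz x y :
  nm (s x y) ^+ 2 <= complex.Re (s x x) * complex.Re (s y y).
Proof.
have sh : s y x = (s x y)^* by apply: sesq_herm => // z; exact: ger0_real.
set A := complex.Re (s x x); set B := complex.Re (s y y); set b := nm (s x y).
have A0 : 0 <= A by rewrite -lecR -ge0_complexE.
have B0 : 0 <= B by rewrite -lecR -ge0_complexE.
have key (r : R) : 0 <= A - 2 * r * b ^+ 2 + r ^+ 2 * b ^+ 2 * B.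
  have := s0 (x - (r%:C%C * s x y) *: y).
  rewrite (sesqBl ss) !(sesqBr ss) !(sesqZl ss) !(sesqZr ss) sh rmorphM/=.
  rewrite [s x x]ge0_complexE// [s y y]ge0_complexE// -/A -/B conj_realC.
  rewrite (_ : _ - _ - _ = (A - 2 * r * b ^+ 2 + r ^+ 2 * b ^+ 2 * B)%:C%C) ?ler0c//.
  have bE : b%:C%C * b%:C%C = s x y * (s x y)^* by rewrite -sqr_nm -rmorphM.
  by rewrite !(rmorphD, rmorphN, rmorphM, rmorph_nat)/= bE; ring.
have b0 : 0 <= b ^+ 2 by exact: sqr_ge0.
have [B1|B1] := ltP 0 B.
  have := key B^-1.
  have -> : A - 2 / B * b ^+ 2 + B^-1 ^+ 2 * b ^+ 2 * B = A - b ^+ 2 / B.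
    by field; rewrite gt_eqF.
  by rewrite subr_ge0 ler_pdivrMr.
have -> : B = 0 by apply/eqP; rewrite eq_le B1 B0.
rewrite mulr0 leNgt; apply/negP => b1.
have := key ((A + 1) / b ^+ 2); have -> : B = 0 by apply/eqP; rewrite eq_le B1 B0.
rewrite mulr0 addr0 -mulrA divfK ?gt_eqF//; lra.
Qed.

End Psd.

Section InnerProduct.
Variables (R : realType) (H : hilbertSpace R).
Implicit Types x y z : H.

Lemma sesq_dot : sesquilinear (fun x y : H => '[x, y]).
Proof.
split=> a x y z; first by rewrite linearPl.
by rewrite linearPr.
Qed.

Lemma dotDl x y z : '[x + y, z] = '[x, z] + '[y, z].
Proof. exact: (sesqDl sesq_dot). Qed.
Lemma dotDr x y z : '[x, y + z] = '[x, y] + '[x, z].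
Proof. exact: (sesqDr sesq_dot). Qed.
Lemma dotZl a x y : '[a *: x, y] = a * '[x, y].
Proof. exact: (sesqZl sesq_dot). Qed.
Lemma dotZr a x y : '[x, a *: y] = a^* * '[x, y].
Proof. exact: (sesqZr sesq_dot). Qed.
Lemma dotBl x y z : '[x - y, z] = '[x, z] - '[y, z].
Proof. exact: (sesqBl sesq_dot). Qed.
Lemma dotBr x y z : '[x, y - z] = '[x, y] - '[x, z].
Proof. exact: (sesqBr sesq_dot). Qed.
Lemma dotNl x y : '[- x, y] = - '[x, y].
Proof. exact: (sesqNl sesq_dot). Qed.
Lemma dotNr x y : '[x, - y] = - '[x, y].
Proof. exact: (sesqNr sesq_dot). Qed.
Lemma dot0l x : '[0, x] = 0.
Proof. exact: (sesq0l sesq_dot). Qed.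
Lemma dot0r x : '[x, 0] = 0.
Proof. exact: (sesq0r sesq_dot). Qed.

Lemma dot_suml (I : Type) (s : seq I) (P : pred I) (F : I -> H) y :
  '[\sum_(i <- s | P i) F i, y] = \sum_(i <- s | P i) '[F i, y].
Proof.
by apply: (big_morph (fun x => '[x, y])) => [u v|]; rewrite ?dotDl ?dot0l.
Qed.

Lemma dot_sumr (I : Type) (s : seq I) (P : pred I) (F : I -> H) y :
  '[y, \sum_(i <- s | P i) F i] = \sum_(i <- s | P i) '[y, F i].
Proof.
by apply: (big_morph (fun x => '[y, x])) => [u v|]; rewrite ?dotDr ?dot0r.
Qed.

Lemma dotxx x : '[x, x] = (nm x ^+ 2)%:C%C.
Proof. by rewrite hdotE nmE rmorphXn. Qed.

Lemma dotxx_ge0 x : 0 <= '[x, x].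
Proof. by rewrite hdotE exprn_ge0. Qed.

Lemma dotC x y : '[y, x] = '[x, y]^*.
Proof. by apply: (sesq_herm sesq_dot) => z; rewrite ger0_real ?dotxx_ge0. Qed.

Lemma CauchySchwarz x y : nm '[x, y] <= nm x * nm y.
Proof.
rewrite -(@ler_pXn2r _ 2) ?nnegrE ?mulr_ge0 ?nm_ge0//.
have := psd_CauchySchwarz sesq_dot dotxx_ge0 x y.
by rewrite !dotxx/= exprMn.
Qed.

Lemma dot_eq0 x : (forall y, '[x, y] = 0) -> x = 0.
Proof. by move=> /(_ x)/eqP; rewrite dotxx => /eqP[/eqP]; rewrite expf_eq0/= => /eqP/nm_eq0. Qed.

Lemma dot_injl x y : (forall z, '[x, z] = '[y, z]) -> x = y.
Proof.
move=> e; apply/eqP; rewrite -subr_eq0; apply/eqP; apply: dot_eq0 => z.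
by rewrite dotBl e subrr.
Qed.

Lemma parallelogram x y :
  nm (x + y) ^+ 2 + nm (x - y) ^+ 2 = 2 * (nm x ^+ 2 + nm y ^+ 2).
Proof.
have : '[x + y, x + y] + '[x - y, x - y] =
    '[x, x] + '[y, y] + ('[x, x] + '[y, y]).
  by rewrite !(dotDl, dotDr, dotBl, dotBr, dotNl, dotNr); ring.
by rewrite !dotxx => /(congr1 (@complex.Re R))/= ->; ring.
Qed.

End InnerProduct.

(** * Completeness and bounded operators *)

Lemma le_eps (R : realType) (a b : R) :
  (forall e, 0 < e -> a <= b + e) -> a <= b.
Proof. by move=> h; apply/ler_addgt0Pr. Qed.

Lemma geometric_small (R : realType) (C r : R) : 0 <= C -> 0 <= r < 1 ->
  forall e, 0 < e -> exists N, forall k, (N <= k)%N -> C * r ^+ k < e.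
Proof.
move=> C0 /andP[r0 r1] e e0.
have : (fun k => C * r ^+ k) @ \oo --> (0 : R).
  by apply: cvg_geometric; rewrite ger0_norm.
move=> /cvgrPdist_lt/(_ e e0)[N _ hN]; exists N => k /hN.
by rewrite sub0r normrN ger0_norm// mulr_ge0// exprn_ge0.
Qed.

Section Completeness.
Variables (R : realType) (H : hilbertSpace R).

(** Completeness with an explicit rate: the bound e k between terms passes to the
    limit. *)
Lemma complete_nm (u : nat -> H) (e : nat -> R) :
  (forall d, 0 < d -> exists N, forall k, (N <= k)%N -> e k < d) ->
  (forall k m, (k <= m)%N -> nm (u m - u k) <= e k) ->
  exists l : H, forall k, nm (l - u k) <= e k.
Proof.
move=> e_small ue.
have cu : cvg (u @ \oo).
  suff : cauchy_ex (u @ \oo) by move=> /cauchy_exP; exact: cauchy_cvg.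
  move=> _/posnumP[d]; have d_gt0 : 0 < d%:num by [].
  have dE := ge0_complexE (ltW d_gt0).
  have d0 : 0 < complex.Re d%:num by rewrite -ltcR -dE.
  have [N hN] := e_small _ d0.
  exists (u N), N => // m /= Nm; rewrite -ball_normE /ball_/= distrC nmE dE ltcR.
  by rewrite (le_lt_trans (ue _ _ Nm))// hN.
exists (lim (u @ \oo)) => k; apply: le_eps => d d0.
have d0' : 0 < d%:C%C :> R[i] by rewrite ltcR.
have /cvgrPdist_lt/(_ _ d0')[N _ hN] := cu.
have := hN (maxn N k) (leq_maxl _ _); rewrite nmE ltcR => h1.
rewrite -(subrK (u (maxn N k)) (lim _)) -addrA (le_trans (nmD _ _))//.
by rewrite [leRHS]addrC lerD// ?(ltW h1)// ue// leq_maxr.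
Qed.

Lemma geometric_cvg (u : nat -> H) (C r : R) : 0 <= C -> 0 <= r < 1 ->
  (forall k, nm (u k.+1 - u k) <= C * r ^+ k) ->
  exists l : H, forall k, nm (l - u k) <= C / (1 - r) * r ^+ k.
Proof.
move=> C0 r01 uC; have /andP[r0 r1] := r01.
have r1' : 0 < 1 - r by rewrite subr_gt0.
apply: complete_nm => [|k m km].
  by apply: geometric_small => //; rewrite divr_ge0// ltW.
rewrite -(subnK km); elim: (m - k)%N => [|j IH].
  by rewrite add0n subrr nm0 mulr_ge0 ?exprn_ge0// divr_ge0// ltW.
suff {IH} h j' : nm (u (j' + k)%N - u k) <= C / (1 - r) * r ^+ k * (1 - r ^+ j').
  rewrite (le_trans (h _))// ler_piMr//.
    by rewrite mulr_ge0 ?exprn_ge0// divr_ge0// ltW.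
  by rewrite gerBl exprn_ge0.
elim: j' => [|j' IH]; first by rewrite add0n subrr nm0 expr0 subrr mulr0.
rewrite -(subrK (u (j' + k)%N) (u _)) -addrA (le_trans (nmD _ _))//.
rewrite addSn (le_trans (lerD (uC _) IH))// le_eqVlt; apply/orP; left; apply/eqP.
by rewrite exprD exprS; field; rewrite gt_eqF.
Qed.

End Completeness.

Section BoundedOps.
Variables (R : realType) (H : hilbertSpace R).
Implicit Types A B : bop H.

Lemma bop_real_bound A : exists2 M : R, 0 <= M & forall x, nm (A x) <= M * nm x.
Proof.
have [M AM] := bop_bounded A; exists (nm M) => [|x]; first exact: nm_ge0.
rewrite -lecR rmorphM/= -!nmE -[`|x| in leRHS]normr_id -normrM.
by rewrite (le_trans (AM x))// real_ler_norm// ger0_real// (le_trans _ (AM x)).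
Qed.

Definition opb A : R := sval (cid2 (bop_real_bound A)).

Lemma opb_ge0 A : 0 <= opb A.
Proof. by rewrite /opb; case: cid2. Qed.

Lemma opbP A x : nm (A x) <= opb A * nm x.
Proof. by rewrite /opb; case: cid2. Qed.

Lemma bop_build (f : H -> H) (M : R) : linear f ->
  (forall x, nm (f x) <= M * nm x) -> exists A, forall x, A x = f x.
Proof.
move=> lf bf.
have bf' : exists M : R[i], forall x, `|f x| <= M * `|x|.
  by exists M%:C%C => x; rewrite !nmE -rmorphM lecR.
by exists (Bop lf bf').
Qed.

Lemma bopB A B x : (A - B) x = A x - B x. Proof. by []. Qed.
Lemma bopD A B x : (A + B) x = A x + B x. Proof. by []. Qed.
Lemma bopZ (c : R[i]) A x : (c *: A) x = c *: A x. Proof. by []. Qed.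
Lemma bopM A B x : (A * B) x = A (B x). Proof. by []. Qed.
Lemma bop1 x : (1 : bop H) x = x. Proof. by []. Qed.
Lemma bop0 x : (0 : bop H) x = 0. Proof. by []. Qed.

Lemma bop_sum (I : Type) (s : seq I) (P : pred I) (F : I -> bop H) x :
  (\sum_(i <- s | P i) F i) x = \sum_(i <- s | P i) F i x.
Proof. by apply: (big_morph (fun A : bop H => A x)) => [A B|]. Qed.

Lemma nm_limit_linear (F : nat -> H -> H) (f : H -> H) (e : nat -> H -> R) :
  (forall k, linear (F k)) ->
  (forall x d, 0 < d -> exists N, forall k, (N <= k)%N -> e k x < d) ->
  (forall k x, nm (f x - F k x) <= e k x) -> linear f.
Proof.
move=> lF e_small fF a x y; apply/eqP; rewrite -subr_eq0; apply/eqP/nm_eq0/eqP.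
rewrite eq_le nm_ge0 andbT; apply: le_eps => d d0; rewrite add0r.
have d3 : 0 < d / (2 + nm a) by rewrite divr_gt0// ltr_pwDl ?nm_ge0.
have [N1 h1] := e_small (a *: x + y) _ d3.
have [N2 h2] := e_small x _ d3.
have [N3 h3] := e_small y _ d3.
pose N := maxn N1 (maxn N2 N3).
have := h1 N (leq_maxl _ _).
have := h2 N; rewrite !leq_max leqnn orbT => /(_ isT).
have := h3 N; rewrite !leq_max leqnn !orbT => /(_ isT).
have := fF N (a *: x + y); have := fF N x; have := fF N y.
set P := f (_ + _); rewrite lF => k3 k2 k1 j3 j2 j1.
have -> : P - (a *: f x + f y) = (P - (a *: F N x + F N y))
   - (a *: (f x - F N x) + (f y - F N y)).
  by rewrite scalerBr addrACA -opprD opprB addrA subrK.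
apply: (le_trans (nmD _ _)); apply: (@le_trans _ _ (d / (2 + nm a) * (2 + nm a))).
  rewrite mulrDr; apply: (@le_trans _ _ (d / (2 + nm a) +
    (nm a * (d / (2 + nm a)) + d / (2 + nm a)))); last lra.
  apply: lerD; first by apply: (le_trans k1); exact: ltW.
  rewrite nmN; apply: (le_trans (nmD _ _)); rewrite nmZ; apply: lerD.
    by rewrite ler_wpM2l ?nm_ge0// (le_trans k2)// ltW.
  by rewrite (le_trans k3)// ltW.
by rewrite divfK// gt_eqF// ltr_pwDl ?nm_ge0.
Qed.

(** Serves as completeness of L(H): every limit of operators below (Neumann
    series, square root, inverse of Phi) comes with a geometric rate relative to
    the size of the vector. *)
Lemma bop_lim (Y : nat -> bop H) (C r : R) : 0 <= C -> 0 <= r < 1 ->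
  (forall k x, nm (Y k.+1 x - Y k x) <= C * r ^+ k * nm x) ->
  exists L : bop H, forall k x, nm (L x - Y k x) <= C / (1 - r) * r ^+ k * nm x.
Proof.
move=> C0 r01 hY; have /andP[r0 r1] := r01.
have C1 : 0 <= C / (1 - r) by rewrite divr_ge0// subr_ge0 ltW.
have /choice[f hf] : forall x, exists l, forall k,
    nm (l - Y k x) <= C / (1 - r) * r ^+ k * nm x.
  move=> x; have [|k|l hl] := @geometric_cvg R H (fun k => Y k x) (C * nm x) r _ r01.
  - by rewrite mulr_ge0// nm_ge0.
  - by rewrite mulrAC.
  - by exists l => k; rewrite (le_trans (hl k))//; rewrite le_eqVlt; apply/orP; left;
      apply/eqP; ring.
have lf : linear f.
  apply: (@nm_limit_linear (fun k => Y k) f (fun k x => C / (1 - r) * r ^+ k * nm x)).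
  - by move=> k a x y; exact: linearP.
  - move=> x d d0.
    have [|N hN] := @geometric_small _ (C / (1 - r) * nm x) r _ r01 d d0.
      by rewrite mulr_ge0// nm_ge0.
    by exists N => k /hN; rewrite mulrAC.
  - by move=> k x.
have [|L hL] := @bop_build f (C / (1 - r) + opb (Y 0)) lf.
  move=> x; rewrite -(subrK (Y 0 x) (f x)) (le_trans (nmD _ _))// mulrDl lerD//.
    by have := hf x 0; rewrite expr0 mulr1.
  exact: opbP.
by exists L => k x; rewrite hL.
Qed.

End BoundedOps.

(** * Riesz representation and adjoints *)

Lemma quad_ge0_lin0 (R : realType) (a b : R) : 0 <= b ->
  (forall t, 0 <= 2 * t * a + t ^+ 2 * b) -> a = 0.
Proof.
move=> b0 h; apply/eqP; rewrite -sqrf_eq0 eq_le sqr_ge0 andbT leNgt; apply/negP => a0.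
(* near the minimizer -a/b, and defined even if b = 0 *)
have := h (- a / (b + 1)); have b1 : 0 < b + 1 by lra.
have -> : 2 * (- a / (b + 1)) * a + (- a / (b + 1)) ^+ 2 * b
  = - (a ^+ 2 * (b + 2) / (b + 1) ^+ 2) by field; rewrite gt_eqF.
have b2 : 0 < b + 2 by lra.
rewrite oppr_ge0; apply/negP; rewrite -ltNge.
by apply: divr_gt0; [exact: mulr_gt0|exact: exprn_gt0].
Qed.

Section Riesz.
Variables (R : realType) (H : hilbertSpace R).

(** The representing vector minimizes |x|^2 - 2 Re (l x); minimizing sequences
    are Cauchy by the parallelogram law. *)
Lemma riesz (l : H -> R[i]) (M : R) : 0 <= M ->
  (forall a x y, l (a *: x + y) = a * l x + l y) ->
  (forall x, nm (l x) <= M * nm x) -> exists v : H, forall x, l x = '[x, v].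
Proof.
move=> M0 ll lM.
have lD x y : l (x + y) = l x + l y by have := ll 1 x y; rewrite scale1r mul1r.
have l0 : l 0 = 0 by apply: (addrI (l 0)); rewrite -lD !addr0.
have lZ a x : l (a *: x) = a * l x by have := ll a x 0; rewrite !addr0 l0 addr0.
pose J (x : H) : R := nm x ^+ 2 - 2 * complex.Re (l x).
have Jlb x : - M ^+ 2 <= J x.
  have := lM x; have := nm_Re (l x); rewrite ler_norml => /andP[_ h1] h2.
  have : 0 <= nm x ^+ 2 - 2 * (M * nm x) + M ^+ 2.
    by rewrite (_ : _ + _ = (nm x - M) ^+ 2) ?sqr_ge0//; ring.
  by rewrite /J; lra.
pose m := inf (range J).
have hJ : has_inf (range J).
  by split; [exists (J 0), 0|exists (- M ^+ 2) => _ [x _ <-]].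
have mJ x : m <= J x by apply: ge_inf; [exact: hJ.2|exists x].
have q0 : 0 < 4^-1 :> R by lra.
have /choice[u uJ] k : exists x, J x < m + 4^-1 ^+ k.
  have [_ [x _ <-] xJ] := inf_adherent (exprn_gt0 k q0) hJ.
  by exists x.
have JD x y : J (x + y) = J x + J y + 2 * complex.Re '[x, y].
  rewrite /J lD; have := dotxx (x + y).
  rewrite !(dotDl, dotDr) !dotxx (dotC x y) => /(congr1 (@complex.Re R)) /=.
  by case: '[x, y] => a b /= <-; case: (l x) => ? ?; case: (l y) => ? ? /=; ring.
have [v hv] : exists v, forall k, nm (v - u k) <= 2 * 2^-1 ^+ k.
  apply: complete_nm; first by apply: geometric_small => //; lra.
  move=> k j kj; rewrite -(@ler_pXn2r _ 2) ?nnegrE ?mulr_ge0 ?nm_ge0 ?exprn_ge0//; [|lra..].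
  have := mJ (2^-1 *: (u j + u k)); rewrite {1}/J nmZ lZ lD.
  have e2 : (2^-1 : R[i]) = (2^-1 : R)%:C%C by rewrite fmorphV rmorph_nat.
  rewrite e2 nm_real ger0_norm ?invr_ge0//.
  have := parallelogram (u j) (u k).
  have := uJ j; have := uJ k; rewrite /J.
  have : 4^-1 ^+ j <= 4^-1 ^+ k :> R by rewrite ler_wiXn2l//; lra.
  have -> : (2 * 2^-1 ^+ k) ^+ 2 = 4 * 4^-1 ^+ k :> R.
    by rewrite exprMn -exprM mulnC exprM; congr (_ * _ ^+ _); lra.
  rewrite exprMn; case: (l (u j)) => a b; case: (l (u k)) => c d /=; lra.
exists v => x; apply/esym/eqP; rewrite -subr_eq0; apply/eqP.
have dotRe (y z : H) : complex.Re '[z, y] = complex.Re '[y, z].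
  by rewrite dotC; case: '[y, z].
(* u k + h cannot beat the infimum; let k tend to infinity *)
have key h : 0 <= 2 * complex.Re ('[h, v] - l h) + nm h ^+ 2.
  apply: le_eps => e e0.
  have C0 : 0 <= 1 + 4 * nm h by have := nm_ge0 h; lra.
  have [|k hk] := @geometric_small _ _ 2^-1 C0 _ e e0; first by lra.
  have {hk} := hk k (leqnn k).
  have := mJ (u k + h); rewrite JD [J h]/J.
  have := uJ k; have := CauchySchwarz h (v - u k); have := nm_Re '[h, v - u k].
  rewrite ler_norml dotBr => /andP[+ _].
  rewrite (dotRe h) => b1 b2; have := ler_wpM2l (nm_ge0 h) (hv k).
  have : 4^-1 ^+ k <= 2^-1 ^+ k :> R by rewrite lerXn2r ?nnegrE//; lra.
  move: b1 b2; set w := nm (_ - _); set w' := nm (v - u k).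
  case: '[h, v] => ? ?; case: '[h, u k] => ? ?; case: (l h) => ? ? /=.
  move: w w' (nm h) (J (u k)) => w w' n j; lra.
have {}key h : complex.Re ('[h, v] - l h) = 0.
  apply: (@quad_ge0_lin0 _ _ (nm h ^+ 2)); first exact: sqr_ge0.
  move=> t; have := key (t%:C%C *: h).
  rewrite dotZl lZ -mulrBr nmZ nm_real exprMn real_normK ?num_real//.
  by case: (_ - _) => a b /=; rewrite mul0r subr0 mulrA.
have := key x; have := key ('i%C *: x); rewrite dotZl lZ -mulrBr.
case: (_ - _) => a b /=; rewrite mul0r mul1r sub0r => /eqP; rewrite oppr_eq0.
by move=> /eqP -> ->.
Qed.


(** The way in which operators are produced: from their bounded forms. *)
Lemma riesz_sesq (s : H -> H -> R[i]) (M : R) : 0 <= M -> sesquilinear s ->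
  (forall x y, nm (s x y) <= M * nm x * nm y) ->
  exists B : bop H, forall x y, s x y = '[B x, y].
Proof.
move=> M0 ss sM.
have /choice[f hf] x : exists v, forall y, s x y = '[v, y].
  have [|||v hv] := @riesz (fun y => (s x y)^*) (M * nm x).
  - by rewrite mulr_ge0 ?nm_ge0.
  - by move=> a y z; rewrite ss.2 rmorphD rmorphM/= conjCK.
  - by move=> y; rewrite nm_conj.
  - by exists v => y; rewrite dotC -hv conjCK.
have [||B hB] := @bop_build R H f M.
- by move=> a x y; apply: dot_injl => z; rewrite -hf ss.1 dotDl dotZl !hf.
- move=> x; have [->|fx0] := eqVneq (f x) 0; first by rewrite nm0 mulr_ge0 ?nm_ge0.
  have fx1 : 0 < nm (f x).
    by rewrite lt_neqAle nm_ge0 andbT eq_sym; apply: contra fx0 => /eqP/nm_eq0/eqP.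
  rewrite -(ler_pM2r fx1); have := sM x (f x).
  by rewrite hf dotxx nm_real ger0_norm ?sqr_ge0// expr2.
by exists B => x y; rewrite hB.
Qed.

Lemma sesq_bop (A : bop H) : sesquilinear (fun x y => '[A x, y]).
Proof.
by split=> a x y z; rewrite ?linearP ?dotDl ?dotZl ?dotDr ?dotZr.
Qed.

Lemma dot_bop_bound (A : bop H) x y : nm '[A x, y] <= opb A * nm x * nm y.
Proof. by rewrite (le_trans (CauchySchwarz _ _))// ler_wpM2r ?nm_ge0 ?opbP. Qed.

Lemma adj_exists (A : bop H) : exists B : bop H, forall x y, '[A x, y] = '[x, B y].
Proof.
have [|||B hB] := @riesz_sesq (fun y x => '[y, A x]) (opb A).
- exact: opb_ge0.
- by split=> a x y z; rewrite ?linearP ?dotDl ?dotZl ?dotDr ?dotZr.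
- move=> x y; rewrite (le_trans (CauchySchwarz _ _))//.
  by rewrite [leRHS]mulrAC [leRHS]mulrC ler_wpM2l ?nm_ge0 ?opbP.
by exists B => x y; rewrite dotC hB -dotC.
Qed.

Lemma adjP (A : bop H) x y : '[A x, y] = '[x, adj A y].
Proof.
by rewrite /adj; case: xgetP => [B _ /(_ x y)//|]; have [B hB] := adj_exists A => /(_ B)[].
Qed.

Lemma adjPl (A : bop H) x y : '[adj A x, y] = '[x, A y].
Proof. by rewrite dotC -adjP -dotC. Qed.

Lemma bop_injl (A B : bop H) : (forall x y, '[A x, y] = '[B x, y]) -> A = B.
Proof. by move=> h; apply: bop_ext => x; apply: dot_injl => y. Qed.

Lemma bop_polar (A B : bop H) : (forall x, '[A x, x] = '[B x, x]) -> A = B.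
Proof.
by move=> h; apply: bop_injl; apply: (sesq_polar (sesq_bop A) (sesq_bop B)).
Qed.

Lemma adjE (A B : bop H) : (forall x y, '[A x, y] = '[x, B y]) -> adj A = B.
Proof. by move=> h; apply: bop_injl => x y; rewrite adjPl dotC h -dotC. Qed.

Lemma adjM (A B : bop H) : adj (A * B) = adj B * adj A.
Proof. by apply: adjE => x y; rewrite !bopM !adjP. Qed.

Lemma adj1 : adj 1 = 1 :> bop H.
Proof. exact: adjE. Qed.

Lemma adj0 : adj 0 = 0 :> bop H.
Proof. by apply: adjE => x y; rewrite dot0l dot0r. Qed.

Lemma psd_selfadj (A : bop H) : posop A -> adj A = A.
Proof.
move=> A0; apply: adjE => x y.
have /(_ x y) := sesq_herm (sesq_bop A) (fun z => ger0_real (A0 z)).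
by move=> /(congr1 Num.conj); rewrite conjCK -dotC.
Qed.

End Riesz.

(** * Coercive operators: inverses and square roots *)

Section CoerciveOperators.
Variables (R : realType) (H : hilbertSpace R).
Implicit Types A B S : bop H.

Lemma bopBr A x y : A (x - y) = A x - A y. Proof. exact: linearB. Qed.
Lemma bopDr A x y : A (x + y) = A x + A y. Proof. exact: linearD. Qed.
Lemma bopZr A (c : R[i]) x : A (c *: x) = c *: A x. Proof. exact: linearZ. Qed.
Lemma bopr0 A : A 0 = 0. Proof. exact: linear0. Qed.

Definition coercive A : Prop :=
  exists2 d : R, 0 < d & forall x, (d * nm x ^+ 2)%:C%C <= '[A x, x].

Lemma coercive_posop A : coercive A -> posop A.
Proof.
move=> [d d0 hd] x; apply: le_trans (hd x).
by rewrite ler0c mulr_ge0 ?sqr_ge0// ltW.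
Qed.

Lemma coercive_pos A x : coercive A -> x != 0 -> 0 < '[A x, x].
Proof.
move=> [d d0 hd] x0; apply: lt_le_trans (hd x).
rewrite ltcR mulr_gt0// exprn_gt0// lt_neqAle nm_ge0 andbT eq_sym.
by apply: contra x0 => /eqP/nm_eq0/eqP.
Qed.

Lemma posop_Re A x : posop A -> '[A x, x] = (complex.Re '[A x, x])%:C%C.
Proof. by move=> /(_ x)/ge0_complexE. Qed.

(** Cauchy-Schwarz for the form of B, applied to x and B x. *)
Lemma posop_norm_le B (q : R) : 0 <= q -> posop B ->
  (forall x, complex.Re '[B x, x] <= q * nm x ^+ 2) ->
  forall x, nm (B x) <= q * nm x.
Proof.
move=> q0 B0 Bq x.
have := psd_CauchySchwarz (sesq_bop B) B0 x (B x).
rewrite dotxx nm_real ger0_norm ?sqr_ge0// => h.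
have h2 : nm (B x) ^+ 2 ^+ 2 <= (q * nm x) ^+ 2 * nm (B x) ^+ 2.
  apply: (le_trans h); have -> : (q * nm x) ^+ 2 * nm (B x) ^+ 2 =
    (q * nm x ^+ 2) * (q * nm (B x) ^+ 2) by ring.
  by rewrite ler_pM// -ler0c -posop_Re.
rewrite -(@ler_pXn2r _ 2) ?nnegrE ?mulr_ge0 ?nm_ge0//.
have [->|n0] := eqVneq (nm (B x)) 0; first by rewrite expr0n sqr_ge0.
have n1 : 0 < nm (B x) ^+ 2 by rewrite exprn_gt0// lt_neqAle eq_sym n0 nm_ge0.
by rewrite -(ler_pM2r n1) -expr2.
Qed.

(** Divide A by M larger than its norm: the form of 1 - A / M then lies between
    0 and 1 - d / M, where d is the lower bound of A. *)
Lemma coercive_contraction A : coercive A ->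
  exists M B q, [/\ 0 < M, A = M%:C%C *: (1 - B), posop B, 0 <= q < 1 &
    forall x, nm (B x) <= q * nm x].
Proof.
move=> cA; have A0 := coercive_posop cA; have [d d0 hd] := cA.
pose M := opb A + d; have M0 : 0 < M by rewrite ltr_wpDl ?opb_ge0.
have dM : d <= M by rewrite lerDr opb_ge0.
pose B : bop H := 1 - (M^-1)%:C%C *: A.
have BE x : '[B x, x] = (nm x ^+ 2 - M^-1 * complex.Re '[A x, x])%:C%C.
  by rewrite bopB bopZ bop1 dotBl dotZl dotxx [in LHS]posop_Re// -rmorphM -rmorphB.
have q0 : 0 <= 1 - d / M < 1.
  by rewrite subr_ge0 ler_pdivrMr// mul1r dM/= gtrBl divr_gt0.
exists M, B, (1 - d / M).
have B0 : posop B.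
  move=> x; rewrite BE ler0c subr_ge0 mulrC ler_pdivrMr//.
  have := dot_bop_bound A x x; rewrite posop_Re// nm_real => h.
  have h2 := le_trans (ler_norm _) h.
  apply: (le_trans h2); rewrite -mulrA -expr2 mulrC ler_wpM2l ?sqr_ge0//.
  by rewrite lerDl ltW.
split=> //.
  rewrite /B opprB addrC subrK scalerA -rmorphM/= divff ?gt_eqF//.
  by rewrite scale1r.
apply: posop_norm_le => // [|x]; first by case/andP: q0.
rewrite BE /= mulrBl mul1r lerD2l lerN2 mulrAC mulrC ler_wpM2l ?invr_ge0 ?(ltW M0)//.
by rewrite -lecR -(posop_Re _ A0).
Qed.

Lemma eq_geometric (x y : H) (C r : R) : 0 <= C -> 0 <= r < 1 ->
  (forall k, nm (x - y) <= C * r ^+ k) -> x = y.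
Proof.
move=> C0 r01 h; apply/eqP; rewrite -subr_eq0; apply/eqP/nm_eq0/eqP.
rewrite eq_le nm_ge0 andbT; apply: le_eps => e e0; rewrite add0r.
have [N hN] := geometric_small C0 r01 e0.
exact: le_trans (h N) (ltW (hN _ _)).
Qed.

Lemma nm_iter_contraction B (q : R) k x : 0 <= q ->
  (forall x, nm (B x) <= q * nm x) -> nm ((B ^+ k) x) <= q ^+ k * nm x.
Proof.
move=> q0 Bq; elim: k x => [|k IH] x; first by rewrite !expr0 mul1r.
rewrite exprS bopM (le_trans (Bq _))// exprS -mulrA ler_wpM2l//.
Qed.

Lemma neumann B (q : R) : 0 <= q < 1 ->
  (forall x, nm (B x) <= q * nm x) -> invertible (1 - B).
Proof.
move=> q01 Bq; have /andP[q0 q1] := q01.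
pose Y k : bop H := \sum_(i < k) B ^+ i.
have YS k : Y k.+1 = Y k + B ^+ k by rewrite /Y big_ord_recr.
have Yl k : (1 - B) * Y k = 1 - B ^+ k.
  elim: k => [|k IH]; first by rewrite /Y big_ord0 mulr0 expr0 subrr.
  by rewrite YS mulrDr IH mulrBl mul1r -exprS addrA subrK.
have Yr k : Y k * (1 - B) = 1 - B ^+ k.
  elim: k => [|k IH]; first by rewrite /Y big_ord0 mul0r expr0 subrr.
  by rewrite YS mulrDl IH mulrBr mulr1 -exprSr addrA subrK.
have [k x|L hL] := @bop_lim R H Y 1 q ler01 q01.
  rewrite YS bopD [X in nm X]addrC addKr mul1r.
  exact: nm_iter_contraction.
set C := 1 / (1 - q) in hL.
have C0 : 0 <= C by rewrite divr_ge0// subr_ge0 ltW.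
exists L; split; apply: bop_ext => x; rewrite bop1 bopM.
- pose D := opb (1 - B).
  apply: (@eq_geometric _ _ ((D * C + 1) * nm x) q) => // [|k].
    by rewrite mulr_ge0 ?nm_ge0// addr_ge0// mulr_ge0 ?opb_ge0.
  have -> : (1 - B) (L x) - x = (1 - B) (L x - Y k x) - (B ^+ k) x.
    by rewrite bopBr -[(1 - B) (Y k x)]bopM Yl bopB bop1 opprB addrA [RHS]addrAC addrK.
  apply: (le_trans (nmD _ _)); rewrite nmN.
  have := opbP (1 - B) (L x - Y k x); rewrite -/D => h1.
  have := ler_wpM2l (opb_ge0 (1 - B)) (hL k x); rewrite -/D => h2.
  have h3 := nm_iter_contraction k x q0 Bq.
  apply: (le_trans (lerD h1 h3)); apply: (le_trans (lerD h2 (lexx _))).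
  by rewrite le_eqVlt; apply/orP; left; apply/eqP; ring.
- apply: (@eq_geometric _ _ (C * nm ((1 - B) x) + nm x) q) => // [|k].
    by rewrite addr_ge0 ?nm_ge0// mulr_ge0 ?nm_ge0.
  have -> : L ((1 - B) x) - x = L ((1 - B) x) - Y k ((1 - B) x) - (B ^+ k) x.
    by rewrite -[Y k _]bopM Yr bopB bop1 opprB addrA [RHS]addrAC addrK.
  apply: (le_trans (nmD _ _)); rewrite nmN.
  apply: (le_trans (lerD (hL k _) (nm_iter_contraction k x q0 Bq))).
  by rewrite le_eqVlt; apply/orP; left; apply/eqP; ring.
Qed.

Lemma invertibleZ (c : R[i]) A : c != 0 -> invertible A -> invertible (c *: A).
Proof.
move=> c0 [B [AB BA]]; exists (c^-1 *: B).
have sc (a b : R[i]) (P Q : bop H) : (a *: P) * (b *: Q) = (a * b) *: (P * Q).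
  by apply: bop_ext => x; rewrite !(bopM, bopZ) bopZr scalerA.
by rewrite !sc AB BA mulfV// mulVf// scale1r.
Qed.

Lemma coercive_invertible A : coercive A -> invertible A.
Proof.
move=> /coercive_contraction[M [B [q [M0 -> _ q01 Bq]]]].
apply: invertibleZ; last exact: neumann Bq.
by rewrite gt_eqF// ltcR.
Qed.

Lemma coercive_posdef A : coercive A -> posdef A.
Proof.
by move=> cA; split=> [x|]; [exact: coercive_pos|exact: coercive_invertible].
Qed.

(** If A B = 1, Cauchy-Schwarz for the form of A at B x and x gives
    |x|^4 <= <x, B x> <A x, x>, and B is bounded. *)
Lemma posdef_coercive A : posdef A -> coercive A.
Proof.
move=> [Apos [B [AB BA]]].
have A0 : posop A.
  by move=> x; have [->|/Apos/ltW//] := eqVneq x 0; rewrite bopr0 dot0l.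
pose N := opb B + 1; have N0 : 0 < N by rewrite ltr_wpDl ?opb_ge0.
exists N^-1 => [|x]; first by rewrite invr_gt0.
rewrite posop_Re// lecR mulrC ler_pdivrMr//.
have := psd_CauchySchwarz (sesq_bop A) A0 (B x) x.
rewrite -[A (B x)]bopM AB bop1 dotxx nm_real ger0_norm ?sqr_ge0// => h.
have h1 : complex.Re '[x, B x] <= N * nm x ^+ 2.
  apply: le_trans (ler_norm _) _; apply: (le_trans (nm_Re _)).
  apply: (le_trans (CauchySchwarz _ _)).
  have -> : N * nm x ^+ 2 = nm x * (N * nm x) by ring.
  by rewrite ler_wpM2l ?nm_ge0// (le_trans (opbP _ _))// ler_wpM2r ?nm_ge0// lerDl.
have [->|n0] := eqVneq (nm x) 0.
  by rewrite expr0n mulr_ge0 ?(ltW N0)// -ler0c -posop_Re.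
have n1 : 0 < nm x ^+ 2 by rewrite exprn_gt0// lt_neqAle eq_sym n0 nm_ge0.
rewrite -(ler_pM2l n1) -expr2 (le_trans h)//.
have -> : nm x ^+ 2 * (complex.Re '[A x, x] * N) = N * nm x ^+ 2 * complex.Re '[A x, x] by ring.
by rewrite ler_wpM2r// -ler0c -posop_Re.
Qed.

(** Up to a positive factor A is 1 - B with B a strict contraction, and the
    square root of 1 - B is 1 - L, where L is the fixed point of
    Y |-> (B + Y^2) / 2. Starting from 0, the iterates keep the bound q < 1 of B,
    and on such operators the map contracts by q. *)
Lemma coercive_sqrt A : coercive A -> exists S, posdef S /\ S * S = A.
Proof.
move=> /coercive_contraction[M [B [q [M0 -> B0 q01 Bq]]]].
have /andP[q0 q1] := q01.
pose h : R[i] := (2^-1 : R)%:C%C.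
have nmh : nm h = 2^-1 by rewrite nm_real ger0_norm.
pose F (Y : bop H) : bop H := h *: (B + Y * Y).
pose Y k : bop H := iter k F 0.
have YS k : Y k.+1 = h *: (B + Y k * Y k) by [].
have Yq k x : nm (Y k x) <= q * nm x.
  elim: k x => [|k IH] x; first by rewrite nm0 mulr_ge0 ?nm_ge0.
  rewrite YS bopZ nmZ nmh mulrC ler_pdivrMr// (le_trans (nmD _ _))//.
  rewrite bopM (le_trans (lerD (Bq _) (IH _)))//.
  have : q * nm (Y k x) <= q * nm x.
    by rewrite ler_wpM2l// (le_trans (IH _))// ler_piMl ?nm_ge0// ltW.
  lra.
have sqB P Q x : (h *: (B + P * P)) x - (h *: (B + Q * Q)) x =
    h *: (P (P x - Q x) + (P (Q x) - Q (Q x))).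
  rewrite !bopZ -scalerBr !bopD !bopM opprD addrACA subrr add0r bopBr.
  by rewrite addrA subrK.
have Yd k x : nm (Y k.+1 x - Y k x) <= q ^+ k * (q * nm x).
  elim: k x => [|k IH] x.
    by rewrite expr0 mul1r bop0 subr0 Yq.
  rewrite (sqB (Y k.+1) (Y k) x : Y k.+2 x - Y k.+1 x = _).
  rewrite nmZ nmh mulrC ler_pdivrMr// (le_trans (nmD _ _))//.
  have e1 : nm (Y k.+1 (Y k.+1 x - Y k x)) <= q * (q ^+ k * (q * nm x)).
    by rewrite (le_trans (Yq _ _))// ler_wpM2l.
  have e2 : nm (Y k.+1 (Y k x) - Y k (Y k x)) <= q ^+ k * (q * (q * nm x)).
    by rewrite (le_trans (IH _))// ler_wpM2l ?exprn_ge0// ler_wpM2l.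
  by apply: (le_trans (lerD e1 e2)); rewrite exprS le_eqVlt; apply/orP; left; apply/eqP; ring.
have [|L hL] := @bop_lim R H Y 1 q ler01 q01.
  move=> k x; rewrite mul1r (le_trans (Yd k x))// ler_wpM2l ?exprn_ge0//.
  by rewrite ler_piMl ?nm_ge0// ltW.
set C := 1 / (1 - q) in hL; have C0 : 0 <= C by rewrite divr_ge0// subr_ge0 ltW.
have Lq x : nm (L x) <= q * nm x.
  apply: le_eps => e e0.
  have [|N hN] := @geometric_small _ (C * nm x) q _ q01 e e0.
    by rewrite mulr_ge0 ?nm_ge0.
  rewrite -(subrK (Y N x) (L x)) (le_trans (nmD _ _))// addrC lerD//.
  by rewrite (le_trans (hL _ _))// mulrAC ltW// hN.
have LE : L = h *: (B + L * L).
  apply: bop_ext => x.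
  apply: (@eq_geometric _ _ ((C + C) * nm x) q) => // [|k].
    by rewrite mulr_ge0 ?nm_ge0// addr_ge0.
  have -> : L x - (h *: (B + L * L)) x =
     (L x - Y k.+1 x) - ((h *: (B + L * L)) x - Y k.+1 x).
    by rewrite opprB addrA subrK.
  apply: (le_trans (nmD _ _)); rewrite nmN.
  rewrite (sqB L (Y k) x : (h *: (B + L * L)) x - Y k.+1 x = _) nmZ nmh.
  have k1 : q * (C * q ^+ k * nm x) <= C * q ^+ k * nm x.
    by rewrite ler_piMl ?(ltW q1)// mulr_ge0 ?nm_ge0// mulr_ge0 ?exprn_ge0.
  have e0 := hL k.+1 x.
  have e1 : nm (L (L x - Y k x)) <= q * (C * q ^+ k * nm x).
    by rewrite (le_trans (Lq _))// ler_wpM2l.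
  have e2 : nm (L (Y k x) - Y k (Y k x)) <= C * q ^+ k * (q * nm x).
    by rewrite (le_trans (hL _ _))// ler_wpM2l// mulr_ge0 ?exprn_ge0.
  have e3 := nmD (L (L x - Y k x)) (L (Y k x) - Y k (Y k x)).
  move: e0; rewrite exprS => e0; lra.
have Badj : adj B = B by exact: psd_selfadj.
have Yadj k x y : '[Y k x, y] = '[x, Y k y].
  elim: k x y => [|k IH] x y; first by rewrite !bop0 dot0l dot0r.
  rewrite !YS !bopZ dotZl dotZr conj_realC !bopD dotDl dotDr adjP Badj.
  by rewrite !bopM !IH.
(* L is a limit of self-adjoint operators, so its form is real *)
have Lreal x : '[L x, x] = (complex.Re '[L x, x])%:C%C.
  have YI k : complex.Im '[Y k x, x] = 0.
    have := Yadj k x x; rewrite [in RHS]dotC.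
    by case: '[_, _] => a b [] /= h1; lra.
  suff : complex.Im '[L x, x] = 0 by case: '[_, _] => a b /= ->.
  apply/eqP; rewrite -normr_eq0 eq_le normr_ge0 andbT; apply: le_eps => e e0.
  have [|N hN] := @geometric_small _ (C * nm x * nm x) q _ q01 e e0.
    by apply: mulr_ge0; [apply: mulr_ge0|] => //; exact: nm_ge0.
  have -> : complex.Im '[L x, x] = complex.Im '[L x - Y N x, x].
    by rewrite dotBl; have := YI N; do 2 case: '[_, _] => ? ? /=; lra.
  rewrite add0r (le_trans (nm_Im _))// (le_trans (CauchySchwarz _ _))//.
  have := ler_wpM2r (nm_ge0 x) (hL N x); have := hN N (leqnn _); lra.
pose s := Num.sqrt M; have s0 : 0 < s by rewrite sqrtr_gt0.
exists (s%:C%C *: (1 - L)); split.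
  apply: coercive_posdef; exists (s * (1 - q)) => [|x].
    by rewrite mulr_gt0// subr_gt0.
  rewrite bopZ bopB bop1 dotZl dotBl dotxx Lreal -rmorphB -rmorphM lecR -mulrA.
  rewrite ler_wpM2l ?(ltW s0)// mulrBl mul1r lerD2l lerN2.
  rewrite (le_trans (ler_norm _))// (le_trans (nm_Re _))//.
  by rewrite (le_trans (CauchySchwarz _ _))// expr2 mulrA ler_wpM2r ?nm_ge0.
apply: bop_ext => x; rewrite !(bopM, bopZ) bopZr scalerA -rmorphM/= -expr2.
rewrite sqr_sqrtr ?(ltW M0)//; congr (_ *: _).
have LE' : B = L + L - L * L.
  rewrite [X in X + X]LE -scalerDr -mulr2n -scaler_nat scalerA.
  rewrite (_ : h * 2%:R = 1) ?scale1r ?addrK//.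
  by rewrite -(rmorph_nat (real_complex R)) -rmorphM mulVf.
rewrite LE' !(bopB, bop1, bopD, bopM) bopBr !opprD !opprK; rewrite -!addrA.
by congr (_ + _); rewrite addrCA.
Qed.

End CoerciveOperators.

(** * Toeplitz forms and the step operator *)

Lemma sqr_sum_le (R : realType) (N : nat) (t : nat -> R) :
  (\sum_(l < N) t l) ^+ 2 <= N%:R * \sum_(l < N) t l ^+ 2.
Proof.
rewrite expr2 big_distrlr/=.
apply: (@le_trans _ _ (\sum_(i < N) \sum_(j < N) (2^-1 * (t i ^+ 2 + t j ^+ 2)))).
  apply: ler_sum => i _; apply: ler_sum => j _.
  by have := sqr_ge0 (t i - t j); rewrite sqrrB; lra.
set Q := \sum_(l < N) t l ^+ 2.
rewrite (eq_bigr (fun i : 'I_N => 2^-1 * (t i ^+ 2 *+ N + Q))); last first.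
  by move=> i _; rewrite -mulr_sumr big_split/= sumr_const card_ord.
rewrite -mulr_sumr big_split/= sumr_const card_ord sumrMnl -/Q -mulr_natl.
by rewrite le_eqVlt; apply/orP; left; apply/eqP; field.
Qed.

Section ToeplitzForm.
Variables (R : realType) (H : hilbertSpace R).
Implicit Types (m : int -> bop H) (f g : nat -> H).

(** <T f, g> for the Toeplitz matrix T of size N with entries m (j - k), on
    coefficient sequences cut at N. *)
Definition tform m N f g : R[i] :=
  \sum_(j < N) \sum_(k < N) '[m (j%:Z - k%:Z) (f k), g j].

Definition hermitian_seq m := forall j x y, '[m j x, y] = '[x, m (- j) y].

Lemma sesq_tform m N : sesquilinear (tform m N : (nat -> H) -> (nat -> H) -> R[i]).
Proof.
split=> a x y z; rewrite /tform mulr_sumr -big_split; apply: eq_bigr => j _;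
  rewrite mulr_sumr -big_split; apply: eq_bigr => k _ /=.
  by rewrite !fctE bopDr bopZr dotDl dotZl.
by rewrite !fctE dotDr dotZr.
Qed.

Lemma tform_ge0_herm m N f g : (forall f, 0 <= tform m N f f) ->
  tform m N g f = (tform m N f g)^*.
Proof. by move=> h; apply: (sesq_herm (sesq_tform m N)) => x; exact: ger0_real. Qed.

Definition vdelta k (x : H) : nat -> H := fun i => if i == k then x else 0.

Lemma tform_delta m N j k x y : (j < N)%N -> (k < N)%N ->
  tform m N (vdelta k x) (vdelta j y) = '[m (j%:Z - k%:Z) x, y].
Proof.
move=> jN kN; rewrite /tform (bigD1 (Ordinal jN))//= [X in _ + X]big1 ?addr0; last first.
  by move=> i ij; apply: big1 => l _; rewrite [vdelta j y _]ifN ?dot0r.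
rewrite (bigD1 (Ordinal kN))//= [X in _ + X]big1 ?addr0; last first.
  by move=> l lk; rewrite [vdelta k x _]ifN ?bopr0 ?dot0l.
by rewrite /vdelta !eqxx.
Qed.

Lemma tform_bound m N : exists2 C : R, 0 <= C & forall f,
  nm (tform m N f f) <= C * (\sum_(i < N) nm (f i)) ^+ 2.
Proof.
exists (\sum_(j < N) \sum_(k < N) opb (m (j%:Z - k%:Z))) => [|f].
  by apply: sumr_ge0 => j _; apply: sumr_ge0 => k _; exact: opb_ge0.
set S := \sum_(i < N) nm (f i).
have fS (i : 'I_N) : nm (f i) <= S.
  by rewrite /S (bigD1 i)//= lerDl sumr_ge0// => *; exact: nm_ge0.
have S0 : 0 <= S by apply: sumr_ge0 => *; exact: nm_ge0.
rewrite (le_trans (nm_sum _ _ _))// mulr_suml ler_sum// => j _.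
rewrite (le_trans (nm_sum _ _ _))// mulr_suml ler_sum// => k _.
rewrite (le_trans (dot_bop_bound _ _ _))// expr2 -mulrA ler_wpM2l ?opb_ge0//.
by rewrite ler_pM// nm_ge0.
Qed.

End ToeplitzForm.

Section Step.
Variables (R : realType) (H : hilbertSpace R).
Variables (n : nat) (a : nat -> bop H).
Implicit Types (m : int -> bop H) (f g : nat -> H).

(** Coefficients of z (g(z) - Phi(z) g_n): reduce the polynomial g of degree at
    most n modulo the monic Phi = sum_i z^i a_i, then multiply by z. *)
Definition step g : nat -> H :=
  fun i => if i is i'.+1 then g i' - a i' (g n) else 0.

(** Relation (1) of the introduction. *)
Definition orth m (kappa : bop H) := forall k, (k <= n)%N ->
  \sum_(i < n.+1) m (k%:Z - i%:Z) * a i = if k == n then kappa else 0.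

Hypothesis an : a n = 1.

(** With x = g_n, split g = p + Phi x, where p has degree less than n. The two
    parts are orthogonal, Phi x has energy <kappa x, x>, and the shift from p to
    [step g] does not change the form. *)
Lemma tform_step m kappa g : (forall f g, tform m n.+1 g f = (tform m n.+1 f g)^*) ->
  orth m kappa ->
  tform m n.+1 g g = tform m n.+1 (step g) (step g) + '[kappa (g n), g n].
Proof.
move=> mh mo; pose p i := g i - a i (g n); pose F i := a i (g n).
have pn : p n = 0 by rewrite /p an bop1 subrr.
have Fl f : tform m n.+1 F f = '[kappa (g n), f n].
  transitivity (\sum_(j < n.+1) '[(if val j == n then kappa else 0) (g n), f j]).
    apply: eq_bigr => j _; rewrite -dot_suml; congr ('[_, _]).
    by rewrite -(mo j) ?bop_sum// -ltnS.
  rewrite (bigD1 ord_max)//= eqxx big1 ?addr0// => j jn.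
  by rewrite ifN ?bop0 ?dot0l.
have ss := sesq_tform m n.+1.
have -> : g = (p : nat -> H) + (F : nat -> H).
  by apply/funext => i; rewrite !fctE /p subrK.
rewrite (sesqDl ss p F) !(sesqDr ss p F) !Fl (mh F p) Fl pn !dot0r conjC0 addr0 add0r.
have En : ((p : nat -> H) + (F : nat -> H)) n = g n by rewrite !fctE pn /F an add0r.
rewrite En; congr (_ + _); last by rewrite /F an.
have Estep : step (p + F) = step g.
  by apply/funext => -[|i]//; rewrite /step En /= !fctE /p subrK.
rewrite Estep /tform [RHS]big_ord_recl/= [X in X + _]big1 ?add0r; last first.
  by move=> k _; rewrite dot0r.
rewrite big_ord_recr/= [X in _ + X]big1 ?addr0; last by move=> k _; rewrite pn dot0r.
apply: eq_bigr => j _; rewrite big_ord_recr/= pn bopr0 dot0l addr0.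
rewrite [RHS]big_ord_recl/= bopr0 dot0l add0r; apply: eq_bigr => k _.
congr ('[m _ _, _]); rewrite /bump/= !add1n !intS; ring.
Qed.

End Step.

(** * Decay of the step and uniqueness of the moments *)

Section Decay.
Variables (R : realType) (H : hilbertSpace R).
Variables (n : nat) (a : nat -> bop H) (m : int -> bop H) (kappa : bop H).
Implicit Types (f g : nat -> H).
Hypotheses (an : a n = 1) (mo : orth n a m kappa) (kc : coercive kappa)
  (m0 : forall f, 0 <= tform m n.+1 f f).
Local Notation st := (step n a).

Let W g : R := complex.Re (tform m n.+1 g g).
Let l1 g : R := \sum_(i < n.+1) nm (g i).

Let W0 g : 0 <= W g. Proof. by rewrite -ler0c -ge0_complexE. Qed.
Let l10 g : 0 <= l1 g. Proof. by apply: sumr_ge0 => *; exact: nm_ge0. Qed.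

Let W_step g : W g = W (st g) + complex.Re '[kappa (g n), g n].
Proof.
have mh f h : tform m n.+1 h f = (tform m n.+1 f h)^* by exact: tform_ge0_herm.
by rewrite /W (tform_step an _ mh mo); case: (tform _ _ _ _) => ? ?; case: '[_, _].
Qed.

(** A step can be undone once the leading coefficient that it removes is known:
    g_i = (step g)_(i+1) + a_i g_n. *)
Lemma step_observable : exists2 K : R, 0 <= K & forall g i, (i <= n)%N ->
  nm (g i) <= K * \sum_(l < n.+1) nm (iter l st g n).
Proof.
pose K := 1 + \sum_(i < n.+1) opb (a i).
have K1 : 1 <= K by rewrite lerDl sumr_ge0// => *; exact: opb_ge0.
have K0 : 0 <= K by rewrite (le_trans ler01).
have aK (i : 'I_n.+1) : opb (a i) <= K.
  rewrite /K (bigD1 i)//= addrCA lerDl addr_ge0// sumr_ge0// => *; exact: opb_ge0.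
have obs j g : (j <= n)%N -> nm (g (n - j)%N) <= K * \sum_(l < j.+1) nm (iter l st g n).
  elim: j g => [|j IH] g jn.
    by rewrite subn0 big_ord1/= ler_peMl ?nm_ge0.
  have := IH (st g) (ltnW jn); rewrite -(subnSK jn).
  set b := (n - j.+1)%N; set S := \sum_(l < _) _ => h.
  have -> : \sum_(l < j.+2) nm (iter l st g n) = nm (g n) + S.
    by rewrite big_ord_recl; congr (_ + _); apply: eq_bigr => l _; rewrite -iterSr.
  have -> : g b = st g b.+1 + a b (g n) by rewrite /= subrK.
  rewrite (le_trans (nmD _ _))// mulrDr addrC lerD//.
  have bn : (b < n.+1)%N by rewrite ltnS leq_subr.
  by rewrite (le_trans (opbP _ _))// ler_wpM2r ?nm_ge0// (aK (Ordinal bn)).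
exists K => // g i i_n; have := obs (n - i)%N g (leq_subr _ _).
rewrite subKn// => /le_trans; apply; rewrite ler_wpM2l//.
rewrite -!(big_mkord xpredT (fun l => nm (iter l st g n))).
rewrite [leRHS](@big_cat_nat _ _ _ (n - i).+1)//= ?ltnS ?leq_subr// lerDl.
by apply: sumr_ge0 => *; exact: nm_ge0.
Qed.

Let W_iter_le k g : W (iter k st g) <= W g.
Proof.
elim: k => //= k; apply: le_trans; rewrite [leRHS]W_step lerDl -ler0c -posop_Re//.
all: exact: coercive_posop.
Qed.

Let W_telescope d N g : (forall x, (d * nm x ^+ 2)%:C%C <= '[kappa x, x]) ->
  d * \sum_(l < N) nm (iter l st g n) ^+ 2 <= W g - W (iter N st g).
Proof.
move=> hd; elim: N => [|N IH]; first by rewrite big_ord0 mulr0 subrr.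
rewrite big_ord_recr/= mulrDr.
have := hd (iter N st g n); rewrite posop_Re ?lecR; last exact: coercive_posop.
by have := W_step (iter N st g) => /=; lra.
Qed.

(** The energy lost in n + 1 steps dominates the squares of the leading
    coefficients, hence the energy itself by [step_observable]. *)
Lemma energy_decay : exists2 r : R, 0 <= r < 1 &
  forall k g, W (iter (k * n.+1) st g) <= r ^+ k * W g.
Proof.
have [K K0 hK] := step_observable; have [d d0 hd] := kc.
have [C C0 hC] := tform_bound m n.+1.
pose D := C * (n.+1%:R * K) ^+ 2 * n.+1%:R / d.
have D0 : 0 <= D.
  by rewrite divr_ge0 ?(ltW d0)// mulr_ge0// mulr_ge0// sqr_ge0.
have D1 : 0 < D + 1 by rewrite ltr_wpDl.
have one g : W (iter n.+1 st g) <= D / (D + 1) * W g.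
  have h1 := W_telescope n.+1 g hd.
  set X := \sum_(l < n.+1) _ in h1.
  have h2 : W g <= D * (d * X).
    apply: le_trans (ler_norm _) _; apply: (le_trans (nm_Re _)).
    apply: (le_trans (hC _)).
    pose Y := \sum_(l < n.+1) nm (iter l st g n).
    have Y0 : 0 <= Y by apply: sumr_ge0 => *; exact: nm_ge0.
    have h3 : l1 g <= n.+1%:R * K * Y.
      rewrite -mulrA mulr_natl -[n.+1 in leRHS]card_ord -sumr_const.
      by apply: ler_sum => i _; apply: hK; rewrite -ltnS.
    have h4 : l1 g ^+ 2 <= (n.+1%:R * K) ^+ 2 * (n.+1%:R * X).
      apply: (@le_trans _ _ ((n.+1%:R * K * Y) ^+ 2)).
        by rewrite lerXn2r ?nnegrE// mulr_ge0// mulr_ge0.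
      rewrite exprMn ler_wpM2l ?sqr_ge0//.
      exact: (sqr_sum_le n.+1 (fun l => nm (iter l st g n))).
    apply: (le_trans (ler_wpM2l C0 h4)); rewrite le_eqVlt; apply/orP; left; apply/eqP.
    by rewrite /D; field; rewrite gt_eqF.
  rewrite mulrAC ler_pdivlMr//.
  have h5 : W g <= D * (W g - W (iter n.+1 st g)).
    by rewrite (le_trans h2)// ler_wpM2l.
  have := W_iter_le n.+1 g; lra.
exists (D / (D + 1)).
  by rewrite divr_ge0 ?(ltW D1)//= ltr_pdivrMr// mul1r ltrDl.
elim=> [|k IH] g; first by rewrite mul0n expr0 mul1r.
rewrite mulSn iterD exprS (le_trans (one _))// -[leRHS]mulrA ler_wpM2l//.
by rewrite divr_ge0 ?(ltW D1).
Qed.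

(** Coefficients are controlled by later leading coefficients, and these by the
    square root of the remaining energy. *)
Lemma step_decay : exists C r : R, [/\ 0 <= C, 0 <= r < 1 &
  forall k l g i, (i <= n)%N ->
    nm (iter (k * n.+1 + l) st g i) <= C * r ^+ k * \sum_(i < n.+1) nm (g i)].
Proof.
have [K K0 hK] := step_observable; have [d d0 hd] := kc.
have [C C0 hC] := tform_bound m n.+1.
have [r /andP[r0 r1] hr] := energy_decay.
pose E := K * (n.+1%:R * Num.sqrt (C / d)).
exists E, (Num.sqrt r); split.
- by rewrite !mulr_ge0// sqrtr_ge0.
- by rewrite sqrtr_ge0/= -sqrtr1 ltr_sqrt.
move=> k l g i i_n; rewrite -/(l1 g).
apply: (le_trans (hK _ _ i_n)); rewrite -!mulrA ler_wpM2l//.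
have -> : n.+1%:R * (Num.sqrt (C / d) * (Num.sqrt r ^+ k * l1 g)) =
  \sum_(j < n.+1) (Num.sqrt (C / d) * (Num.sqrt r ^+ k * l1 g)).
  by rewrite sumr_const card_ord mulr_natl.
apply: ler_sum => j _; rewrite -iterD.
set x := iter _ st g n.
rewrite -(@ler_pXn2r _ 2) ?nnegrE ?nm_ge0//; last first.
  by rewrite mulr_ge0 ?sqrtr_ge0// mulr_ge0 ?exprn_ge0 ?sqrtr_ge0.
rewrite !exprMn -exprM mulnC exprM !sqr_sqrtr//; last by rewrite divr_ge0// ltW.
rewrite mulrAC ler_pdivlMr// mulrC.
apply: (@le_trans _ _ (complex.Re '[kappa x, x])).
  by rewrite -lecR -posop_Re//; exact: coercive_posop.
rewrite mulrC -[leRHS]mulrA.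
have h1 : complex.Re '[kappa x, x] <= W (iter (j + (k * n.+1 + l)) st g).
  by rewrite [leRHS]W_step lerDr.
apply: (le_trans h1); rewrite addnC -addnA iterD (le_trans (hr _ _))//.
rewrite ler_wpM2l ?exprn_ge0// (le_trans (W_iter_le _ _))//.
by rewrite mulrC (le_trans (ler_norm _))// (le_trans (nm_Re _)).
Qed.

End Decay.

(** By [tform_step] the difference of the two forms is invariant under the step,
    whose iterates tend to 0. *)
Lemma orth_tform_unique (R : realType) (H : hilbertSpace R) n (a : nat -> bop H)
    (m m' : int -> bop H) (kappa : bop H) :
  a n = 1 -> orth n a m kappa -> orth n a m' kappa -> coercive kappa ->
  (forall f, 0 <= tform m n.+1 f f) -> (forall f, 0 <= tform m' n.+1 f f) ->
  forall j, (`|j| <= n)%N -> m j = m' j.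
Proof.
move=> an mo mo' kc m0 m0'.
have [C [r [C0 r01 hr]]] := step_decay an mo kc m0.
have [D D0 hD] := tform_bound m n.+1; have [D' D0' hD'] := tform_bound m' n.+1.
have mh f g : tform m n.+1 g f = (tform m n.+1 f g)^* by exact: tform_ge0_herm.
have mh' f g : tform m' n.+1 g f = (tform m' n.+1 f g)^* by exact: tform_ge0_herm.
pose dl f := tform m n.+1 f f - tform m' n.+1 f f.
have dl_iter k f : dl f = dl (iter k (step n a) f).
  elim: k => //= k ->; rewrite /dl (tform_step an _ mh mo) (tform_step an _ mh' mo').
  by rewrite opprD addrACA subrr addr0.
have dl0 f : dl f = 0.
  pose S := \sum_(i < n.+1) nm (f i).
  have S0 : 0 <= S by apply: sumr_ge0 => *; exact: nm_ge0.
  have /andP[r0 r1] := r01.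
  have rr : 0 <= r ^+ 2 < 1 by rewrite sqr_ge0/= expr_lt1.
  apply/nm_eq0/eqP; rewrite eq_le nm_ge0 andbT; apply: le_eps => e e0.
  pose P := (D + D') * (n.+1%:R * (C * S)) ^+ 2.
  have P0 : 0 <= P by rewrite mulr_ge0 ?sqr_ge0 ?addr_ge0.
  have [k hk] := geometric_small P0 rr e0.
  rewrite add0r (dl_iter (k * n.+1 + 0)%N); apply: le_trans (ltW (hk k (leqnn k))).
  set g := iter _ _ f.
  have gS : \sum_(i < n.+1) nm (g i) <= n.+1%:R * (C * S) * r ^+ k.
    rewrite -mulrA mulr_natl -[n.+1 in leRHS]card_ord -sumr_const.
    by apply: ler_sum => i _; rewrite mulrAC; apply: hr; rewrite -ltnS.
  have gS2 : (\sum_(i < n.+1) nm (g i)) ^+ 2 <= (n.+1%:R * (C * S)) ^+ 2 * (r ^+ 2) ^+ k.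
    rewrite -exprM mulnC exprM -exprMn lerXn2r ?nnegrE//.
      by apply: sumr_ge0 => *; exact: nm_ge0.
    by rewrite !mulr_ge0 ?exprn_ge0.
  rewrite (le_trans (nmD _ _))// nmN /P -mulrA mulrDl lerD//.
    by rewrite (le_trans (hD _))// ler_wpM2l.
  by rewrite (le_trans (hD' _))// ler_wpM2l.
have e f g : tform m n.+1 f g = tform m' n.+1 f g.
  apply: (sesq_polar (sesq_tform m n.+1) (sesq_tform m' n.+1)) => x.
  by apply/eqP; rewrite -subr_eq0; apply/eqP; exact: dl0.
move=> [] j jn; apply: bop_injl => x y.
  have := e (vdelta 0 x) (vdelta j y).
  by rewrite !tform_delta ?subr0.
have := e (vdelta j.+1 x) (vdelta 0 y).
by rewrite !tform_delta ?sub0r -?NegzE.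
Qed.

(** * The inverse of a monic orthogonal polynomial on the circle *)

Section Inverse.
Variables (R : realType) (H : hilbertSpace R).
Variables (n : nat) (a : nat -> bop H).
Implicit Types (z : R[i]) (f g : nat -> H) (G : nat -> bop H).
Local Notation st := (step n a).

Definition peval z f : H := \sum_(i < n.+1) z ^+ i *: f i.
Definition opoly z : bop H := \sum_(i < n.+1) z ^+ i *: a i.

Definition ostep G : nat -> bop H :=
  fun i => if i is i'.+1 then G i' - a i' * G n else 0.

Definition odelta0 : nat -> bop H := fun i => if i == 0%N then 1 else 0.

(** The coefficient of z^-k in the expansion of Phi(z)^-1 at infinity is the
    leading coefficient after k steps from the constant polynomial 1. *)
Definition ucoef k : bop H := iter k ostep odelta0 n.

Definition upart N z : bop H := \sum_(k < N) z ^- k *: ucoef k.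

Lemma iter_ostepE k i x : iter k ostep odelta0 i x = iter k st (vdelta 0 x) i.
Proof.
elim: k i => [|k IH] [|i] //=.
by rewrite !IH.
Qed.

Lemma ucoefE k x : ucoef k x = iter k st (vdelta 0 x) n.
Proof. exact: iter_ostepE. Qed.

Lemma iter_ostep_shift k i : (k <= n)%N -> (i <= n)%N ->
  iter k ostep odelta0 i = if i == k then 1 else 0.
Proof.
elim: k i => [|k IH] [|i] //= kn i_n.
rewrite !IH// ?(ltnW kn) ?(ltnW i_n)// eqSS [n == k]gtn_eqF// mulr0 subr0//.
Qed.

Lemma ucoef_lt k : (k < n)%N -> ucoef k = 0.
Proof. by move=> kn; rewrite /ucoef iter_ostep_shift// ?(ltnW kn)// gtn_eqF. Qed.

Lemma ucoef_n : ucoef n = 1.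
Proof. by rewrite /ucoef iter_ostep_shift// eqxx. Qed.

Hypothesis an : a n = 1.

Lemma peval_step z g : peval z (st g) = z *: (peval z g - opoly z (g n)).
Proof.
rewrite /peval big_ord_recl/= scaler0 add0r /opoly bop_sum -sumrB scaler_sumr.
rewrite [RHS]big_ord_recr/= an bop1 subrr scaler0 addr0.
apply: eq_bigr => i _; rewrite /bump/= add1n -scalerBr scalerA -exprS.
by [].
Qed.

Lemma peval_delta0 z x : peval z (vdelta 0 x) = x.
Proof.
rewrite /peval big_ord_recl/= expr0 scale1r big1 ?addr0// => i _.
by rewrite /vdelta/= scaler0.
Qed.

(** Telescoping of [peval_step]: the remainder of the expansion of Phi(z)^-1 x is
    an iterate of the step started at the constant polynomial x. *)
Lemma opoly_upart N z x : z != 0 ->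
  opoly z (upart N z x) = x - z ^- N *: peval z (iter N st (vdelta 0 x)).
Proof.
move=> z0; elim: N => [|N IH].
  by rewrite /upart big_ord0 bopr0 expr0 invr1 scale1r /= peval_delta0 subrr.
have -> : upart N.+1 z x = upart N z x + z ^- N *: ucoef N x.
  by rewrite /upart big_ord_recr.
rewrite bopDr IH bopZr ucoefE iterS peval_step scalerA.
rewrite (_ : z ^- N.+1 * z = z ^- N); last by rewrite exprSr invfM mulrVK// unitfE.
by rewrite scalerBr opprB addrA addrAC.
Qed.

(** If Phi(z) x = 0, then g(s) = s Phi(s) x / (s - z) is an eigenvector of the
    step with eigenvalue z. As |z| = 1 its energy is preserved, while the step
    lowers it by <kappa x, x>. *)
Lemma opoly_inj m kappa z x : orth n a m kappa -> coercive kappa ->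
  (forall f, 0 <= tform m n.+1 f f) -> nm z = 1 -> opoly z x = 0 -> x = 0.
Proof.
move=> mo kc m0 z1 zx0.
have z0 : z != 0 by apply/eqP => z0; move: z1; rewrite z0 nm0 => /eqP; rewrite eq_sym oner_eq0.
pose g i := \sum_(i <= k < n.+1) z ^+ (k - i) *: a k x.
have gE i : (i <= n)%N -> g i = a i x + z *: g i.+1.
  move=> i_n; rewrite /g big_ltn ?ltnS// subnn expr0 scale1r; congr (_ + _).
  rewrite scaler_sumr !big_nat; apply: eq_bigr => k /andP[ik _].
  by rewrite scalerA -exprS subnSK.
have gn : g n = x by rewrite /g big_nat1 subnn expr0 scale1r an.
have g0 : g 0 = 0.
  rewrite -zx0 /opoly bop_sum /g big_mkord; apply: eq_bigr => k _.
  by rewrite subn0.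
have stg : forall i, (i <= n)%N -> st g i = z *: g i.
  move=> [|i] i_n /=; first by rewrite g0 scaler0.
  by rewrite gn gE 1?ltnW// addrC addKr.
have mh f h : tform m n.+1 h f = (tform m n.+1 f h)^* by exact: tform_ge0_herm.
have := tform_step an g mh mo; rewrite gn.
have -> : tform m n.+1 (st g) (st g) = tform m n.+1 g g.
  rewrite /tform; apply: eq_bigr => j _; apply: eq_bigr => k _.
  have jn : (j <= n)%N by rewrite -ltnS.
  have kn : (k <= n)%N by rewrite -ltnS.
  rewrite (stg j)// (stg k)// bopZr dotZl dotZr mulrA -sqr_nm z1 expr1n.
  by rewrite mul1r.
move=> e; have k0 : '[kappa x, x] = 0.
  by apply: (addrI (tform m n.+1 g g)); rewrite addr0 -e.
apply/eqP/negPn/negP => /(coercive_pos kc); by rewrite k0 ltxx.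
Qed.

(** The remainders of the expansion decay uniformly in z, so its limit is a right
    inverse; it is a left inverse because Phi(z) is injective. *)
Lemma opoly_inverse m kappa : orth n a m kappa -> coercive kappa ->
  (forall f, 0 <= tform m n.+1 f f) ->
  exists C r : R, [/\ 0 <= C, 0 <= r < 1 & forall z, nm z = 1 ->
    exists V : bop H, [/\ V * opoly z = 1, opoly z * V = 1 &
      forall k x, nm (V x - upart (k * n.+1) z x) <= C * r ^+ k * nm x]].
Proof.
move=> mo kc m0.
have [C [r [C0 r01 hr]]] := step_decay an mo kc m0.
have /andP[r0 r1] := r01.
have d1 x : \sum_(i < n.+1) nm (vdelta 0 x i) = nm x.
  rewrite big_ord_recl big1 ?addr0// => i _; rewrite /vdelta/= nm0//.
exists (n.+1%:R * C / (1 - r)), r; split=> //.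
  by rewrite divr_ge0 ?mulr_ge0// subr_ge0 ltW.
move=> z z1.
have z0 : z != 0 by apply/eqP => z0; move: z1; rewrite z0 nm0 => /eqP; rewrite eq_sym oner_eq0.
have zX k : nm (z ^- k) = 1.
  by have := nmM (z ^- k) (z ^+ k); rewrite mulVf ?expf_neq0// nm1 nmX z1 expr1n mulr1.
have [|k x|V hV] := @bop_lim R H (fun k => upart (k * n.+1) z) (n.+1%:R * C) r _ r01.
- by rewrite mulr_ge0.
- rewrite -bopB /upart mulSn addnC big_split_ord/= addrAC subrr add0r bop_sum.
  rewrite (le_trans (nm_sum _ _ _))// -!mulrA mulr_natl -[n.+1 in leRHS]card_ord.
  rewrite -sumr_const ler_sum// => i _; rewrite nmZ zX mul1r ucoefE mulrA.
  by rewrite -[nm x]d1 hr.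
exists V; suff PV : opoly z * V = 1.
  split=> //; apply: bop_ext => x; rewrite bop1; apply/eqP; rewrite -subr_eq0.
  apply/eqP; apply: (opoly_inj mo kc m0 z1).
  by rewrite bopBr -[opoly z _]bopM mulrA PV mul1r subrr.
apply: bop_ext => x; rewrite bop1 bopM.
set D := n.+1%:R * C / (1 - r) in hV *.
have D0 : 0 <= D by rewrite divr_ge0 ?mulr_ge0// subr_ge0 ltW.
apply: (@eq_geometric _ _ _ _ ((opb (opoly z) * D + n.+1%:R * C) * nm x) r) => // [|k].
  by apply: mulr_ge0 (nm_ge0 _); apply: addr_ge0; apply: mulr_ge0 => //; exact: opb_ge0.
have -> : opoly z (V x) - x = opoly z (V x - upart (k * n.+1) z x) -
    z ^- (k * n.+1) *: peval z (iter (k * n.+1) st (vdelta 0 x)).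
  by rewrite bopBr opoly_upart// opprB addrA [RHS]addrAC addrK.
have e1 : nm (z ^- (k * n.+1) *: peval z (iter (k * n.+1) st (vdelta 0 x))) <=
    n.+1%:R * (C * r ^+ k * nm x).
  rewrite nmZ zX mul1r (le_trans (nm_sum _ _ _))// mulr_natl -[n.+1 in leRHS]card_ord.
  rewrite -sumr_const ler_sum// => i _; rewrite nmZ nmX z1 expr1n mul1r.
  by have := hr k 0 (vdelta 0 x) i; rewrite d1 addn0; apply; rewrite -ltnS.
have e2 : nm (opoly z (V x - upart (k * n.+1) z x)) <=
    opb (opoly z) * (D * r ^+ k * nm x).
  by rewrite (le_trans (opbP _ _))// ler_wpM2l ?opb_ge0.
rewrite (le_trans (nmD _ _))// nmN (le_trans (lerD e2 e1))//.
by rewrite le_eqVlt; apply/orP; left; apply/eqP; ring.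
Qed.

End Inverse.

(** * Orthogonal polynomials and Toeplitz matrices *)

Section RingInverse.
Variable S : pzRingType.
Implicit Types a b : S.

Lemma rinvP a : invertible a -> a * rinv a = 1 /\ rinv a * a = 1.
Proof.
move=> [b ab]; rewrite /rinv; case: xgetP => [c _ //|/(_ b)].
by case.
Qed.

Lemma rinvE a b : a * b = 1 -> b * a = 1 -> rinv a = b.
Proof.
move=> ab ba; have [h _] : a * rinv a = 1 /\ rinv a * a = 1 by apply: rinvP; exists b.
by rewrite -[LHS]mul1r -ba -mulrA h mulr1.
Qed.

End RingInverse.

Section Coefficients.
Variables (R : realType) (H : hilbertSpace R).
Variables (mu : set (circle R) -> bop H).
Local Notation m := (moment mu).

(** The value 1 beyond the range of the solution vector is the leading
    coefficient, at i = n. *)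
Definition Phi_coef n i : bop H :=
  if insub i is Some k then - (opmx_inv (toepR mu n) *m nuv mu n) (k : 'I_n) 0 else 1.

Lemma Phi_coef_lt n (k : 'I_n) :
  Phi_coef n k = - (opmx_inv (toepR mu n) *m nuv mu n) k 0.
Proof. by rewrite /Phi_coef valK. Qed.

Lemma Phi_coef_n n : Phi_coef n n = 1.
Proof. by rewrite /Phi_coef insubF ?ltnn. Qed.

Lemma PhiRE n z : PhiR mu n z = opoly n (Phi_coef n) z.
Proof.
rewrite /PhiR /opoly big_ord_recr/= Phi_coef_n addrC; congr (_ + _).
rewrite -mulmxA mxE -sumrN; apply: eq_bigr => k _.
rewrite Phi_coef_lt mxE scalerN; congr (- _).
by apply: bop_ext => x.
Qed.

Hypothesis nt : nontrivial mu.

Lemma toep_gt0 N (f : nat -> H) i : (i < N)%N -> f i != 0 -> 0 < tform m N f f.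
Proof.
move=> iN fi; have [] := nt (leq_ltn_trans (leq0n i) iN).
move=> [/(_ [ffun k : 'I_N => f k]) + _] _.
have -> : \sum_(j < N) '[\sum_(k < N) toepR mu N j k ([ffun k0 : 'I_N => f k0] k),
    [ffun k : 'I_N => f k] j] = tform m N f f.
  apply: eq_bigr => j _; rewrite dot_suml; apply: eq_bigr => k _.
  by rewrite !ffunE mxE.
apply; apply: contra fi => /eqP/ffunP/(_ (Ordinal iN)).
by rewrite !ffunE => ->.
Qed.

Lemma toep_ge0 N (f : nat -> H) : 0 <= tform m N f f.
Proof.
have [[i iN fi]|h] := pselect (exists2 i, (i < N)%N & f i != 0).
  exact: ltW (toep_gt0 iN fi).
rewrite /tform big1// => j _; apply: big1 => k _.
have -> : f j = 0 by apply/eqP/negPn/negP => fj; apply: h; exists j.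
by rewrite dot0r.
Qed.

(** A Toeplitz form that is nonnegative is in particular real, hence hermitian;
    read off its entries. *)
Lemma moment_herm : hermitian_seq m.
Proof.
suff h j k x y : '[m (j%:Z - k%:Z) x, y] = '[x, m (k%:Z - j%:Z) y].
  move=> [] j x y; first by have := h j 0 x y; rewrite subr0 sub0r.
  by have := h 0 j.+1 x y; rewrite subr0 sub0r NegzE opprK.
pose N := (maxn j k).+1.
have jN : (j < N)%N by rewrite ltnS leq_maxl.
have kN : (k < N)%N by rewrite ltnS leq_maxr.
rewrite -(tform_delta m _ _ jN kN) (tform_ge0_herm _ _ (@toep_ge0 N)).
by rewrite tform_delta// -dotC.
Qed.

Lemma adj_moment j : adj (m j) = m (- j).
Proof. by apply: adjE => x y; exact: moment_herm. Qed.

Lemma toepRV n : toepR mu n *m opmx_inv (toepR mu n) = 1%:M /\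
  opmx_inv (toepR mu n) *m toepR mu n = 1%:M.
Proof.
case: n => [|n]; first by rewrite !thinmx0; split; apply/matrixP => -[].
by have [[_ /rinvP]] := nt (ltn0Sn n).
Qed.

(** For k < n these are the equations T_n a = - nu_n for the coefficients, and
    for k = n the definition of kappa_n. *)
Lemma Phi_orth n : orth n (Phi_coef n) m (kappaR mu n).
Proof.
move=> k kn; rewrite big_ord_recr/= Phi_coef_n mulr1.
rewrite (eq_bigr (fun i : 'I_n => - (m (k%:Z - i%:Z) *
    (opmx_inv (toepR mu n) *m nuv mu n) i 0))); last first.
  by move=> i _; rewrite Phi_coef_lt mulrN.
rewrite sumrN; have [->|nk] := eqVneq k n.
  rewrite subrr addrC /kappaR; congr (_ - _).
  rewrite -mulmxA mxE; apply: eq_bigr => i _.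
  by rewrite !mxE adj_moment opprB.
have {nk}kn : (k < n)%N by rewrite ltn_neqAle nk.
have := congr1 (fun M : 'cV_n => M (Ordinal kn) 0)
   (congr1 (fun M => M *m nuv mu n) (toepRV n).1).
rewrite mul1mx -mulmxA mxE [in RHS]mxE /= => <-.
apply/eqP; rewrite addrC subr_eq0; apply/eqP; apply: eq_bigr => i _.
by rewrite mxE.
Qed.

Lemma kappaR_form n x :
  '[kappaR mu n x, x] = tform m n.+1 (fun i => Phi_coef n i x) (fun i => Phi_coef n i x).
Proof.
have mh f g : tform m n.+1 g f = (tform m n.+1 f g)^*.
  by apply: tform_ge0_herm => *; exact: toep_ge0.
rewrite (tform_step (Phi_coef_n n) _ mh (@Phi_orth n)) Phi_coef_n bop1.
rewrite {1}/tform big1 ?add0r// => -[[|j] jn] _; apply: big1 => k _ /=.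
  by rewrite dot0r.
by rewrite Phi_coef_n subrr dot0r.
Qed.

(** The form of kappa at x is the energy of Phi x, which is positive as Phi is
    monic. Applying T_(n+1)^-1 to the column of coefficients of Phi, which
    T_(n+1) maps to kappa in the last place, shows that the last diagonal entry
    of T_(n+1)^-1 is a left inverse of kappa; self-adjointness does the rest. *)
Lemma kappaR_coercive n : coercive (kappaR mu n).
Proof.
apply: posdef_coercive; split.
  move=> x x0; rewrite kappaR_form; apply: (@toep_gt0 _ _ n) => //.
  by rewrite Phi_coef_n.
have k0 : posop (kappaR mu n) by move=> x; rewrite kappaR_form toep_ge0.
have [_ ST] := toepRV n.+1; set S := opmx_inv _ in ST.
pose s := S ord_max ord_max.
have sk : s * kappaR mu n = 1.
  pose F : 'cV[bop H]_n.+1 := \col_i Phi_coef n i.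
  have TF : toepR mu n.+1 *m F = \col_i (if i == ord_max then kappaR mu n else 0).
    apply/matrixP => i j; rewrite !mxE -[i == _]/(val i == n).
    have i_n : (i <= n)%N by rewrite -ltnS.
    rewrite -(Phi_orth i_n); apply: eq_bigr => k _.
    by rewrite !mxE.
  have := congr1 (fun M : 'cV_n.+1 => M ord_max 0) (congr1 (fun M => M *m F) ST).
  rewrite /= mul1mx -mulmxA TF mxE [in RHS]mxE Phi_coef_n => <-.
  rewrite (bigD1 ord_max)//= big1 ?addr0; first by rewrite mxE eqxx.
  by move=> i i_n; rewrite mxE ifN ?mulr0.
have ks : kappaR mu n * adj s = 1.
  by rewrite -{1}(psd_selfadj k0) -adjM sk adj1.
exists s; split=> //.
by rewrite -[LHS]mulr1 -[X in _ * X = _]ks mulrA -[_ * s * _]mulrA sk mulr1 ks.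
Qed.

End Coefficients.

(** * Normalized arc length on the circle *)

Section CircleMeasure.
Variable R : realType.

Lemma open_coord (p : R[i] -> R) (U : set R) :
  (forall z w, `|p z - p w| <= nm (z - w)) -> open U ->
  open (p @^-1` U : set R[i]^o).
Proof.
move=> lip; rewrite !openE => oU z /= Uz.
have /nbhs_ballP[e /= e0 he] := oU _ Uz.
apply/nbhs_ballP; exists (e%:C%C); first by rewrite /= ltcR.
move=> w; rewrite -ball_normE /ball_/= nmE ltcR => zw.
by apply: he; rewrite -ball_normE /ball_/= (le_lt_trans (lip _ _)).
Qed.

Lemma measurable_coord (p : R[i] -> R) :
  (forall z w, `|p z - p w| <= nm (z - w)) ->
  measurable_fun [set: circle R] (p \o @cval R).
Proof.
move=> lip; apply: (measurability _ (RGenOpens.measurableE R)).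
move=> _ [U [a [b ->]] <-]; rewrite setTI.
apply: sub_sigma_algebra; exists (p @^-1` `]a, b[%classic) => //.
by apply: open_coord => //; exact: interval_open.
Qed.

Lemma measurable_Re_cval : measurable_fun [set: circle R] (fun z => complex.Re (cval z)).
Proof.
apply: measurable_coord => z w; apply: le_trans (nm_Re _).
by case: z w => a b [c d].
Qed.

Lemma measurable_Im_cval : measurable_fun [set: circle R] (fun z => complex.Im (cval z)).
Proof.
apply: measurable_coord => z w; apply: le_trans (nm_Im _).
by case: z w => a b [c d].
Qed.

Lemma continuous_cis : continuous (fun t : R => cos t +i* sin t : R[i]^o)%C.
Proof.
move=> t; apply/cvgrPdist_lt => e e0.
have eE := ge0_complexE (ltW e0).
have e1 : 0 < complex.Re e / 2 by rewrite divr_gt0// -ltcR -eE.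
have /cvgrPdist_lt/(_ _ e1) hc := @continuous_cos R t.
have /cvgrPdist_lt/(_ _ e1) hs := @continuous_sin R t.
near=> s; rewrite nmE eE ltcR (le_lt_trans (nm_le_ReIm _))//=.
rewrite (splitr (complex.Re e)) ltrD//; near: s; [exact: hc|exact: hs].
Unshelve. all: by end_near. Qed.

Lemma measurable_expi : measurable_fun [set: measurableTypeR R] (@expi R : measurableTypeR R -> circle R).
Proof.
have e : @measurable _ (circle R) =
    <<s (@open (set_type (@unit_circle R)) : set (set (circle R))) >> by [].
apply: (measurability _ e).
move=> _ [_ [V oV <-] <-]; rewrite setTI.
apply: open_measurable; rewrite -comp_preimage.
exact: (open_comp (fun t _ => @continuous_cis t)).
Qed.

Lemma twopi_gt0 : 0 < pi *+ 2 :> R.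
Proof. by rewrite mulrn_wgt0// pi_gt0. Qed.

Definition expi_mfun : {mfun measurableTypeR R >-> circle R} :=
  mfun_Sub (mem_set measurable_expi).

(** Image of the uniform distribution on [0, 2 pi] under t |-> e^(it). *)
Definition arc : probability (circle R) R :=
  distribution (uniform_prob twopi_gt0) expi_mfun.

Lemma integral_arc (f : circle R -> \bar R) : measurable_fun setT f ->
  (forall z, 0 <= f z)%E ->
  (\int[arc]_z f z = ((pi *+ 2)^-1)%R%:E *
     \int[lebesgue_measure]_(t in `[0%R, (pi *+ 2)%R[) f (expi t))%E.
Proof.
move=> mf f0; rewrite /arc ge0_integral_distribution//.
have mfe : measurable_fun [set: measurableTypeR R] (f \o @expi R).
  exact: (measurableT_comp mf measurable_expi).
rewrite integral_uniform//; last by move=> t; exact: f0.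
rewrite subr0; congr (_ * _)%E; rewrite integral_itv_bndo_bndc//.
exact: measurable_funTS.
Qed.

Lemma arc_integralE (A : set (circle R)) (f : circle R -> R) : measurable A ->
  measurable_fun setT f -> (forall z, 0 <= f z) ->
  arc_integral A f = (\int[arc]_(z in A) (f z)%:E)%E.
Proof.
move=> mA mf f0; rewrite [RHS]integral_mkcond integral_arc; last 2 first.
- by apply/(measurable_restrictT _ mA); exact/measurable_funTS/measurable_EFinP.
- by move=> z; rewrite patchE; case: ifP => //; rewrite lee_fin.
rewrite /arc_integral; congr (_ * _)%E.
rewrite [LHS]integral_mkcond [RHS]integral_mkcond; apply: eq_integral => t _.
rewrite !patchE.
have -> : (t \in [set t | 0 <= t < pi *+ 2 /\ A (expi t)]) =
    (t \in `[0%R, (pi *+ 2)%R[%classic) && ((expi t : circle R) \in A).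
  apply/idP/andP => [/set_mem[h At]|[/set_mem h /set_mem At]].
    by split; apply/mem_set; rewrite //= in_itv.
  by apply/mem_set; split => //; move: h; rewrite /= in_itv.
by case: (t \in _); case: (expi t \in A).
Qed.

End CircleMeasure.

(** * Means of bounded measurable functions *)

Section CircleIntegral.
Variable R : realType.
Implicit Types f g : circle R -> R[i].

(** Bounded measurable functions, a class on which [mean] is linear without
    integrability side conditions. *)
Definition bmf f := [/\ measurable_fun setT (fun z => complex.Re (f z)),
  measurable_fun setT (fun z => complex.Im (f z)) &
  exists M : R, forall z, nm (f z) <= M].

Definition mean f : R[i] := cintegral (@arc R) f.

Lemma arc_integrable (f : circle R -> R) (M : R) : measurable_fun setT f ->
  (forall z, `|f z| <= M) -> (@arc R).-integrable setT (EFin \o f).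
Proof.
move=> mf fM; apply: measurable_bounded_integrable => //.
  by rewrite (le_lt_trans (probability_le1 _ _))// ltry.
exists M; split; first exact: num_real.
by move=> x Mx z _; exact: le_trans (fM z) (ltW Mx).
Qed.

Lemma bmf_integrable f : bmf f ->
  (@arc R).-integrable setT (EFin \o (fun z => complex.Re (f z))) /\
  (@arc R).-integrable setT (EFin \o (fun z => complex.Im (f z))).
Proof.
move=> [mr mi [M hM]]; split; apply: (@arc_integrable _ M) => // z.
  exact: le_trans (nm_Re _) (hM z).
exact: le_trans (nm_Im _) (hM z).
Qed.

Lemma meanE f : mean f = ((\int[@arc R]_z complex.Re (f z)) +i*
  (\int[@arc R]_z complex.Im (f z)))%C.
Proof. by []. Qed.

Lemma eq_mean f g : (forall z, f z = g z) -> mean f = mean g.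
Proof. by move=> /funext ->. Qed.

Lemma bmf_cst c : bmf (fun _ => c).
Proof. by split; [exact: measurable_cst|exact: measurable_cst|exists (nm c)]. Qed.

Lemma bmfD f g : bmf f -> bmf g -> bmf (fun z => f z + g z).
Proof.
move=> [fr fi [M hM]] [gr gi [N hN]]; split.
- rewrite (_ : (fun z => _) = (fun z => complex.Re (f z)) \+ (fun z => complex.Re (g z))).
    exact: measurable_funD.
  by apply/funext => z /=; case: (f z) (g z) => ? ? [].
- rewrite (_ : (fun z => _) = (fun z => complex.Im (f z)) \+ (fun z => complex.Im (g z))).
    exact: measurable_funD.
  by apply/funext => z /=; case: (f z) (g z) => ? ? [].
- by exists (M + N) => z; rewrite (le_trans (nmD _ _))// lerD.
Qed.

Lemma bmfM f g : bmf f -> bmf g -> bmf (fun z => f z * g z).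
Proof.
move=> [fr fi [M hM]] [gr gi [N hN]]; split.
- rewrite (_ : (fun z => _) =
     ((fun z => complex.Re (f z)) \* (fun z => complex.Re (g z))) \-
     ((fun z => complex.Im (f z)) \* (fun z => complex.Im (g z)))).
    by apply: measurable_funB; apply: measurable_funM.
  by apply/funext => z /=; case: (f z) (g z) => ? ? [].
- rewrite (_ : (fun z => _) =
     ((fun z => complex.Re (f z)) \* (fun z => complex.Im (g z))) \+
     ((fun z => complex.Im (f z)) \* (fun z => complex.Re (g z)))).
    by apply: measurable_funD; apply: measurable_funM.
  by apply/funext => z /=; case: (f z) (g z) => ? ? [].
- by exists (M * N) => z; rewrite nmM ler_pM// nm_ge0.
Qed.

Lemma bmfZ c f : bmf f -> bmf (fun z => c * f z).
Proof. by apply: bmfM; exact: bmf_cst. Qed.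

Lemma bmf_conj f : bmf f -> bmf (fun z => (f z)^*).
Proof.
move=> [fr fi [M hM]]; split.
- by rewrite (_ : (fun z => _) = (fun z => complex.Re (f z)))//; apply/funext => z; case: (f z).
- rewrite (_ : (fun z => _) = \- (fun z => complex.Im (f z))).
    exact: measurable_funN.
  by apply/funext => z /=; case: (f z).
- by exists M => z; rewrite nm_conj.
Qed.

Lemma bmfN f : bmf f -> bmf (fun z => - f z).
Proof.
by move=> /(bmfZ (-1)); rewrite (_ : (fun z => _) = (fun z => - f z))//;
  apply/funext => z; rewrite mulN1r.
Qed.

Lemma bmfB f g : bmf f -> bmf g -> bmf (fun z => f z - g z).
Proof. by move=> bf /bmfN; exact: bmfD. Qed.

Lemma bmf_sum (I : Type) (s : seq I) (F : I -> circle R -> R[i]) :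
  (forall i, bmf (F i)) -> bmf (fun z => \sum_(i <- s) F i z).
Proof.
move=> bF; elim: s => [|i s IH].
  by rewrite (_ : (fun z => _) = fun _ => 0); [exact: bmf_cst|apply/funext => z; rewrite big_nil].
rewrite (_ : (fun z => _) = fun z => F i z + \sum_(j <- s) F j z); first exact: bmfD.
by apply/funext => z; rewrite big_cons.
Qed.

Lemma bmf_lim (F : nat -> circle R -> R[i]) f (C r : R) : 0 <= C -> 0 <= r < 1 ->
  (forall k, bmf (F k)) -> (forall k z, nm (f z - F k z) <= C * r ^+ k) -> bmf f.
Proof.
move=> C0 r01 bF hF.
have lim (p : R[i] -> R) : (forall x y, p (x - y) = p x - p y) ->
    (forall x, `|p x| <= nm x) -> (forall k, measurable_fun setT (p \o F k)) ->
    measurable_fun setT (p \o f).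
  move=> pB pn mp; apply: (measurable_fun_cvg mp) => z _.
  apply/cvgrPdist_lt => e e0; have [N hN] := geometric_small C0 r01 e0.
  exists N => // k /= Nk; rewrite -pB (le_lt_trans (pn _))//.
  by rewrite (le_lt_trans (hF k z))// hN.
split.
- apply: lim => [[? ?] [? ?]//|x|k]; first exact: nm_Re.
  by have [] := bF k.
- apply: lim => [[? ?] [? ?]//|x|k]; first exact: nm_Im.
  by have [] := bF k.
- have [_ _ [M hM]] := bF 0; exists (C + M) => z.
  rewrite -(subrK (F 0 z) (f z)) (le_trans (nmD _ _))// lerD//.
  by have := hF 0 z; rewrite expr0 mulr1.
Qed.

Lemma meanD f g : bmf f -> bmf g -> mean (fun z => f z + g z) = mean f + mean g.
Proof.
move=> /bmf_integrable[fr fi] /bmf_integrable[gr gi]; rewrite !meanE.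
apply/eqP; rewrite eq_complex /= -!RintegralD//; apply/andP; split; apply/eqP;
  by apply: eq_Rintegral => z _; case: (f z) (g z) => ? ? [].
Qed.

Lemma meanZ c f : bmf f -> mean (fun z => c * f z) = c * mean f.
Proof.
move=> /bmf_integrable[fr fi]; rewrite !meanE; case: c => c d.
have iZ (h : circle R -> R) (k : R) : (@arc R).-integrable setT (EFin \o h) ->
    (@arc R).-integrable setT (EFin \o (fun z => k * h z)).
  by move=> ih; have := integrableZl measurableT k ih.
apply/eqP; rewrite eq_complex /= -!RintegralZl//.
rewrite -RintegralB -?RintegralD//; try exact: iZ.
by apply/andP; split; apply/eqP; apply: eq_Rintegral => z _; case: (f z).
Qed.

Let fine1 (a : R) (x : \bar R) : x = 1%E -> a * fine x = a.
Proof. by move=> ->; rewrite /= mulr1. Qed.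

Lemma mean_cst c : mean (fun _ => c) = c.
Proof.
have h (a : R) : \int[@arc R]_(z in setT) a = a.
  rewrite (@Rintegral_cst _ _ _ (@arc R) setT measurableT a).
  by apply: fine1; exact: probability_setT.
by rewrite meanE; case: c => a b /=; rewrite !h.
Qed.

Lemma meanN f : bmf f -> mean (fun z => - f z) = - mean f.
Proof.
move=> bf; rewrite -mulN1r -meanZ//; apply: eq_mean => z; by rewrite mulN1r.
Qed.

Lemma meanB f g : bmf f -> bmf g -> mean (fun z => f z - g z) = mean f - mean g.
Proof. by move=> bf bg; rewrite meanD ?meanN//; exact: bmfN. Qed.

Lemma mean_conj f : bmf f -> mean (fun z => (f z)^*) = (mean f)^*.
Proof.
move=> /bmf_integrable[fr fi]; rewrite !meanE.
apply/eqP; rewrite eq_complex /=; apply/andP; split; apply/eqP.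
  by apply: eq_Rintegral => z _; case: (f z).
rewrite -mulN1r -RintegralZl//; apply: eq_Rintegral => z _.
by rewrite mulN1r; case: (f z).
Qed.

Lemma mean_sum (I : Type) (s : seq I) (F : I -> circle R -> R[i]) :
  (forall i, bmf (F i)) -> mean (fun z => \sum_(i <- s) F i z) = \sum_(i <- s) mean (F i).
Proof.
move=> bF; elim: s => [|i s IH].
  by rewrite big_nil -[RHS]mean_cst; apply: eq_mean => z; rewrite big_nil.
rewrite big_cons -IH -meanD//; last exact: bmf_sum.
by apply: eq_mean => z; rewrite big_cons.
Qed.

Lemma mean_ge0 f : (forall z, 0 <= f z) -> 0 <= mean f.
Proof.
move=> f0; rewrite meanE lecE /= [X in X == _](_ : _ = 0) ?eqxx/=.
  by apply: Rintegral_ge0 => z _; rewrite -ler0c -ge0_complexE.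
rewrite (@eq_Rintegral _ _ _ (arc R) setT (fun=> 0)); last by move=> z _; exact: ger0_Im.
by rewrite Rintegral_cst// mul0r.
Qed.

Lemma mean_bound f M : bmf f -> (forall z, nm (f z) <= M) -> nm (mean f) <= 2 * M.
Proof.
move=> bf fM; have [fr fi] := bmf_integrable bf; have [mr mi _] := bf.
have b (p : circle R -> R) : measurable_fun setT p -> (forall z, `|p z| <= M) ->
    `|\int[@arc R]_z p z| <= M.
  move=> mp pM; have ip := arc_integrable mp pM.
  rewrite (le_trans (le_normr_Rintegral _ _))//.
  have -> : M = \int[@arc R]_(z in setT) M.
    rewrite (@Rintegral_cst _ _ _ (@arc R) setT measurableT M).
    by apply/esym/fine1; exact: probability_setT.
  apply: le_Rintegral => //.
    by apply: (@arc_integrable _ M) => [|z]; [exact: measurableT_comp|rewrite normr_id].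
  apply: (@arc_integrable _ `|M|) => //; exact: measurable_cst.
rewrite (le_trans (nm_le_ReIm _))// mulr_natl mulr2n lerD//; apply: b => // z.
  exact: le_trans (nm_Re _) (fM z).
exact: le_trans (nm_Im _) (fM z).
Qed.

Lemma nm_cval (z : circle R) : nm (cval z) = 1.
Proof. by rewrite /nm (set_mem (valP z) : `|cval z| = 1). Qed.

Lemma cval_neq0 (z : circle R) : cval z != 0.
Proof. by apply/eqP => z0; have := nm_cval z; rewrite z0 nm0 => /eqP; rewrite eq_sym oner_eq0. Qed.

Lemma conj_cval (z : circle R) : (cval z)^* = (cval z)^-1.
Proof.
apply: (mulfI (cval_neq0 z)); rewrite mulfV ?cval_neq0//.
by rewrite -sqr_nm nm_cval expr1n.
Qed.

Lemma conj_cvalX (z : circle R) j : (cval z ^ j)^* = cval z ^ (- j).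
Proof.
by rewrite rmorphXz ?unitfE ?cval_neq0//= conj_cval exprz_inv.
Qed.

Lemma nm_cvalX (z : circle R) j : nm (cval z ^ j) = 1.
Proof.
have h k : nm (cval z ^+ k) = 1 by rewrite nmX nm_cval expr1n.
case: j => k; first exact: h.
by rewrite NegzE -conj_cvalX nm_conj h.
Qed.

Lemma bmf_cval : bmf (@cval R).
Proof.
split; [exact: measurable_Re_cval|exact: measurable_Im_cval|].
by exists 1 => z; rewrite nm_cval.
Qed.

Lemma bmf_cvalX j : bmf (fun z => cval z ^ j).
Proof.
have h k : bmf (fun z => cval z ^+ k).
  elim: k => [|k IH]; first exact: bmf_cst.
  by rewrite (_ : (fun z => _) = fun z => cval z * cval z ^+ k)
    ?exprS; [apply: bmfM => //; exact: bmf_cval|apply/funext => z; rewrite exprS].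
case: j => k; first exact: h.
rewrite NegzE (_ : (fun z => _) = fun z => (cval z ^+ k.+1)^*); first exact/bmf_conj/h.
by apply/funext => z; rewrite (conj_cvalX z k.+1).
Qed.

End CircleIntegral.

(** * Means of the powers of z *)

Section Fourier.
Variable R : realType.

Lemma FTC_segment (f F : R -> R) (a b : R) : a < b -> continuous f ->
  (forall t : R, is_derive t 1 F (f t)) ->
  (\int[lebesgue_measure]_(t in `[a, b]) (f t)%:E = (F b - F a)%:E)%E.
Proof.
move=> ab cf dF.
have cF : continuous F by move=> t; apply/differentiable_continuous/derivable1_diffP.
rewrite (@continuous_FTC2 _ _ F)//.
- exact: continuous_subspaceT.
- split=> [t _||]; first by have [] := dF t.
    by apply: cvg_at_right_filter; exact: cF.
  by apply: cvg_at_left_filter; exact: cF.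
- by move=> t _; rewrite derive1E derive_val.
Qed.

(** [integral_arc] is about nonnegative functions, so the fundamental theorem of
    calculus is applied to 1 + g. *)
Lemma arc_mean0 (g : circle R -> R) (f F : R -> R) :
  measurable_fun setT g -> (forall z, `|g z| <= 1) ->
  (forall t, g (expi t) = f t) -> continuous f ->
  (forall t : R, is_derive t 1 F (f t)) -> F (pi *+ 2) = F 0 ->
  \int[@arc R]_z g z = 0.
Proof.
move=> mg g1 gf cf dF F0.
have m1g : measurable_fun setT (fun z => 1 + g z) by exact: measurable_funD.
have g0 z : 0 <= 1 + g z by have := g1 z; rewrite ler_norml => /andP[]; lra.
have dG (t : R) : is_derive t 1 (fun t => t + F t) (1 + f t) by apply: (@is_deriveD _ _ _ id F).
have i1 : (\int[@arc R]_z (1 + g z)%:E = 1%:E)%E.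
  rewrite integral_arc//; [|exact/measurable_EFinP].
  rewrite integral_itv_bndo_bndc; last first.
    apply: measurable_funTS; apply/measurable_EFinP.
    exact: (measurableT_comp m1g (@measurable_expi R)).
  under eq_integral do rewrite gf.
  rewrite (@FTC_segment (fun t => 1 + f t) (fun t => t + F t) _ _ (@twopi_gt0 R))//.
    rewrite F0 add0r addrK -EFinM mulVf// gt_eqF//; exact: twopi_gt0.
  by move=> t; apply: continuousD => //; first [exact: cf | exact: cst_continuous].
have ig : (@arc R).-integrable setT (EFin \o g) by exact: arc_integrable g1.
have ic : (@arc R).-integrable setT (EFin \o (fun=> 1 : R)).
  by apply: (@arc_integrable _ _ 1) => // z; rewrite normr1.
have e1 : \int[@arc R]_z (1 + g z) = 1 by rewrite /Rintegral i1.
have e2 : \int[@arc R]_(z in [set: circle R]) (1 : R) = 1.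
  by have := congr1 (@complex.Re R) (@mean_cst R 1); rewrite meanE.
have e3 : \int[@arc R]_z (1 + g z) = \int[@arc R]_(z in [set: circle R]) (1 : R)
    + \int[@arc R]_z g z := RintegralD measurableT ic ig.
by apply: (addrI 1); rewrite addr0 -[in RHS]e1 e3 e2.
Qed.

Lemma expiX t k : (cos t +i* sin t)%C ^+ k = (cos (k%:R * t) +i* sin (k%:R * t))%C :> R[i].
Proof.
elim: k => [|k IH]; first by rewrite expr0 mul0r cos0 sin0.
rewrite exprS IH -natr1 mulrDl mul1r [_ + t]addrC cosD sinD.
by apply/eqP; rewrite eq_complex/= eqxx/= addrC.
Qed.

Lemma mean_cvalX_pos k : (0 < k)%N -> mean (fun z : circle R => cval z ^+ k) = 0.
Proof.
move=> k0; have kr : k%:R != 0 :> R by rewrite pnatr_eq0 -lt0n.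
have [mr mi _] : bmf (fun z : circle R => cval z ^+ k) := bmf_cvalX R k.
have ex t : cval (expi t : circle R) ^+ k =
  (cos (k%:R * t) +i* sin (k%:R * t))%C by rewrite -expiX.
have n1 (z : circle R) : nm (cval z ^+ k) <= 1 by rewrite nmX nm_cval expr1n.
have k2 : k%:R * (pi *+ 2) = 0 + pi *+ (2 * k) :> R.
  by rewrite add0r mulr_natl -mulrnA.
have dk (t : R) : is_derive t 1 (fun t : R => k%:R * t) k%:R.
  by apply: is_derive_eq; rewrite scaler1.
have ck (f : R -> R) : continuous f -> continuous (fun t : R => f (k%:R * t)).
  move=> cf t; apply: (@continuous_comp _ _ _ (fun t : R => k%:R * t) f).
    exact: mulrl_continuous.
  exact: cf.
rewrite meanE; apply/eqP; rewrite eq_complex /=; apply/andP; split; apply/eqP.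
- apply: (@arc_mean0 _ (fun t => cos (k%:R * t)) (fun t => k%:R^-1 * sin (k%:R * t))) => //.
  + by move=> z; exact: le_trans (nm_Re _) (n1 z).
  + by move=> t; rewrite ex.
  + exact/ck/continuous_cos.
  + move=> t; have d1 := is_derive1_comp (is_derive_sin (k%:R * t)) (dk t).
    by apply: is_derive_eq; rewrite /GRing.scale/= mulrCA mulVf// mulr1.
  + by rewrite mulr0 k2 mulrnA (periodicn (@sinD2pi R)).
- apply: (@arc_mean0 _ (fun t => sin (k%:R * t)) (fun t => - (k%:R^-1 * cos (k%:R * t)))) => //.
  + by move=> z; exact: le_trans (nm_Im _) (n1 z).
  + by move=> t; rewrite ex.
  + exact/ck/continuous_sin.
  + move=> t; have d1 := is_derive1_comp (is_derive_cos (k%:R * t)) (dk t).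
    apply: is_derive_eq; rewrite /GRing.scale/=; by field.
  + by rewrite mulr0 k2 mulrnA (periodicn (@cosD2pi R)).
Qed.

Lemma mean_cvalX j : mean (fun z : circle R => cval z ^ j) = if j == 0 then 1 else 0.
Proof.
case: j => [[|k]|k]; first exact: mean_cst.
  exact: mean_cvalX_pos.
have -> : (fun z : circle R => cval z ^ Negz k) = (fun z => (cval z ^+ k.+1)^*).
  by apply/funext => z; rewrite NegzE -conj_cvalX.
by rewrite mean_conj ?mean_cvalX_pos ?conjC0//; exact: bmf_cvalX R k.+1.
Qed.

End Fourier.

(** * Operator measures given by a density *)

Import HBNNSimple.

(** [quad_measure] is a mere set function that agrees with a measure on
    measurable sets; integrals see only those. *)
Lemma eq_integral_setfun d (T : measurableType d) (R : realType)
    (m1 m2 : set T -> \bar R) (f : T -> \bar R) :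
  (forall A, measurable A -> m1 A = m2 A) ->
  (\int[m1]_z f z = \int[m2]_z f z)%E.
Proof.
move=> m12; rewrite /integral.
have e (g : T -> \bar R) :
    [set sintegral m1 h | h in [set h : {nnsfun T >-> R} | forall x, ((h x)%:E <= g x)%E]] =
    [set sintegral m2 h | h in [set h : {nnsfun T >-> R} | forall x, ((h x)%:E <= g x)%E]].
  apply: eq_imagel => h _; apply: eq_fsbigr => r _; rewrite m12//.
by rewrite !e.
Qed.

Section Density.
Variables (R : realType) (H : hilbertSpace R) (w : circle R -> bop H) (M : R).
Hypotheses (M0 : 0 <= M)
  (wM : forall z h g, nm '[w z h, g] <= M * nm h * nm g)
  (wm : weakly_measurable w) (w0 : forall z, posop (w z)).

Lemma density_bmf h g : bmf (fun z => '[w z h, g]).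
Proof. by have [? ?] := wm h g; split=> //; exists (M * nm h * nm g). Qed.

Let rho h z := complex.Re '[w z h, h].

Let rho_ge0 h z : 0 <= rho h z.
Proof. by rewrite -ler0c -(posop_Re _ (w0 z)); exact: w0. Qed.

Let rho_m h : measurable_fun setT (rho h).
Proof. by have [] := wm h h. Qed.

Let rho_bound h z : `|rho h z| <= M * nm h * nm h.
Proof. exact: le_trans (nm_Re _) (wM _ _ _). Qed.

Let rho_int h : (@arc R).-integrable setT (EFin \o rho h).
Proof. exact: arc_integrable (rho_m h) (rho_bound h). Qed.

Lemma sesq_mean (f : circle R -> R[i]) : bmf f ->
  sesquilinear (fun h g => mean (fun z => f z * '[w z h, g])).
Proof.
move=> bf; have b h g : bmf (fun z => f z * '[w z h, g]).
  by apply: bmfM => //; exact: density_bmf.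
split=> a x y z; rewrite -meanZ -?meanD//; try exact: bmfZ; apply: eq_mean => u.
  by rewrite bopDr bopZr dotDl dotZl; ring.
by rewrite dotDr dotZr; ring.
Qed.

Lemma mean_op (f : circle R -> R[i]) : bmf f ->
  exists B : bop H, forall h g, '[B h, g] = mean (fun z => f z * '[w z h, g]).
Proof.
move=> bf; have [_ _ [C fC]] := bf.
have C0 : 0 <= C by rewrite (le_trans _ (fC (expi 0)))// nm_ge0.
have [|h g|B hB] := @riesz_sesq R H _ (2 * (C * M)) _ (sesq_mean bf).
- by rewrite mulr_ge0// mulr_ge0.
- rewrite -!mulrA; apply: mean_bound; first by apply: bmfM => //; exact: density_bmf.
  by move=> z; rewrite nmM ler_pM ?nm_ge0// mulrA.
by exists B => h g; rewrite -hB.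
Qed.

Section Given.
Variable mun : set (circle R) -> bop H.
Hypotheses (mun_povm : is_povm mun) (mun_d : has_density mun w).

Let quad_arc h (A : set (circle R)) : measurable A ->
  quad_measure mun h A = (\int[@arc R]_(z in A) (rho h z)%:E)%E.
Proof. by move=> mA; have [_ _ ->//] := mun_d; exact: arc_integralE (rho_m h) (rho_ge0 h). Qed.

(** The density w is a Radon-Nikodym derivative of the quadratic measure. *)
Lemma integral_density (h : H) (f : circle R -> R) (C : R) :
  measurable_fun setT f -> (forall z, `|f z| <= C) ->
  (\int[quad_measure mun h]_z (f z)%:E = \int[@arc R]_z (f z * rho h z)%:E)%E.
Proof.
move=> mf fC; have [m hm] := mun_povm h.
have mE A : measurable A -> quad_measure mun h A = m A.
  by move=> mA; have [fm e] := hm A mA; rewrite /quad_measure e/= fineK.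
have mfin : (m setT < +oo)%E by have [fm _] := hm _ measurableT; rewrite ltey_eq fm.
pose nu : {finite_measure set (circle R) -> \bar R} := mfrestr measurableT mfin.
have numE A : nu A = m A by rewrite -[A in RHS]setIT.
have nuq A : measurable A -> quad_measure mun h A = nu A.
  by move=> mA; rewrite numE mE.
rewrite (eq_integral_setfun _ nuq).
have nuE A : measurable A -> nu A = (\int[@arc R]_(z in A) (rho h z)%:E)%E.
  by move=> mA; rewrite -quad_arc// nuq.
have dom : nu `<< (@arc R).
  apply/null_content_dominatesP => A mA A0; rewrite nuE//.
  apply: null_set_integral => //; apply: measurable_funTS; apply/measurable_EFinP; exact: rho_m.
have fint : nu.-integrable setT (EFin \o f).
  apply: measurable_bounded_integrable => //.
    by rewrite ltey_eq fin_num_measure.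
  exists C; split; first exact: num_real.
  by move=> x Cx z _; exact: le_trans (fC z) (ltW Cx).
rewrite -(Radon_Nikodym_change_of_variables dom measurableT fint).
have aeq : ae_eq (@arc R) setT (Radon_Nikodym (charge_of_finite_measure nu) (@arc R)) (EFin \o rho h).
  apply: integral_ae_eq => //.
  - exact: Radon_Nikodym_integrable.
  - exact/measurable_EFinP.
  - by move=> A _ mA; rewrite -Radon_Nikodym_integral// -nuE.
apply: ae_eq_integral => //.
- apply: emeasurable_funM; first exact/measurable_EFinP.
  by apply: measurable_int; exact: Radon_Nikodym_integrable.
- by apply/measurable_EFinP; exact: measurable_funM.
- exact: (ae_eqe_mul2l (EFin \o f) aeq).
Qed.

Lemma cintegral_density h f : bmf f ->
  cintegral (quad_measure mun h) f = mean (fun z => f z * '[w z h, h]).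
Proof.
move=> [fr fi [C fC]]; rewrite /mean /cintegral.
rewrite (@integral_density h (fun z => complex.Re (f z)) C)//; last first.
  by move=> z; exact: le_trans (nm_Re _) (fC z).
rewrite (@integral_density h (fun z => complex.Im (f z)) C)//; last first.
  by move=> z; exact: le_trans (nm_Im _) (fC z).
congr (fine _ +i* fine _)%C; apply: eq_integral => z _; congr (_%:E);
  by rewrite [in RHS](posop_Re _ (w0 z)) -/(rho h z); case: (f z) => a b /=; ring.
Qed.

Lemma moment_density j h g :
  '[moment mun j h, g] = mean (fun z => cval z ^ (- j) * '[w z h, g]).
Proof.
have [B hB] := mean_op (bmf_cvalX R (- j)).
have mh h' : '[moment mun j h', h'] = mean (fun z => cval z ^ (- j) * '[w z h', h']).
  rewrite /moment; case: xgetP => [C _ hC|/(_ B)[]].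
    by rewrite hC cintegral_density//; exact: bmf_cvalX.
  by move=> h''; rewrite hB cintegral_density//; exact: bmf_cvalX.
exact: (sesq_polar (sesq_bop _) (sesq_mean (bmf_cvalX R (- j))) mh).
Qed.

Lemma povm_total_density : mun setT = moment mun 0.
Proof.
apply: bop_polar => h; rewrite moment_density oppr0.
have [m hm] := mun_povm h; have [fm e] := hm _ measurableT.
have := quad_arc h measurableT; rewrite /quad_measure e => q.

rewrite meanE; apply/eqP; rewrite eq_complex; apply/andP; split; apply/eqP.
  rewrite -[LHS]/(fine (complex.Re (fine (m setT))%:C%C)%:E) q.
  by congr fine; apply: eq_integral => z _; rewrite expr0z mul1r.
apply/esym; rewrite /=.
rewrite (@eq_Rintegral _ _ _ (arc R) setT (fun=> 0)).
  by rewrite Rintegral_cst// mul0r.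
by move=> z _; rewrite expr0z mul1r; exact: ger0_Im (w0 z h).
Qed.

End Given.

Let dens h (A : set (circle R)) : \bar R := (\int[@arc R]_(z in A) (rho h z)%:E)%E.

Let dens_measure h : exists m : {measure set (circle R) -> \bar R},
  forall A, m A = dens h A.
Proof.
have d0 : dens h set0 = 0%E by rewrite /dens integral_set0.
have dge A : (0 <= dens h A)%E.
  by apply: integral_ge0 => z _; rewrite lee_fin rho_ge0.
have dsa : semi_sigma_additive (dens h).
  move=> /= F mF tF mUF; rewrite /dens; apply: cvg_toP.
    apply: ereal_nondecreasing_is_cvgn => i j ij.
    apply: lee_sum_nneg_natr => // k _ _.
    by apply: integral_ge0 => z _; rewrite lee_fin rho_ge0.
  rewrite ge0_integral_bigcup//=.
    by apply: measurable_funTS; apply/measurable_EFinP; exact: rho_m.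
  by move=> z _; rewrite lee_fin rho_ge0.
pose m : {measure set (circle R) -> \bar R} :=
  HB.pack (dens h) (isMeasure.Build _ _ _ (dens h) d0 dge dsa).
by exists m.
Qed.

Let ind (A : set (circle R)) (z : circle R) : R[i] := (\1_A z)%:C%C.

Let bmf_ind A : measurable A -> bmf (ind A).
Proof.
move=> mA; split; first exact: measurable_indic.
  exact: measurable_cst.
exists 1 => z; rewrite nm_real indicE.
by case: (z \in A); rewrite /= ?normr1 ?normr0.
Qed.

(** Each mun(A) is obtained from its form, the mean of the form of w over A. *)
Lemma povm_of_density : exists mun, is_povm mun /\ has_density mun w.
Proof.
pose mun A : bop H := xget 0
  [set B : bop H | forall h g, '[B h, g] = mean (fun z => ind A z * '[w z h, g])].
have munP A h : measurable A -> '[mun A h, h] = (fine (dens h A))%:C%C.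
  move=> mA; have -> : '[mun A h, h] = mean (fun z => ind A z * '[w z h, h]).
    rewrite /mun; case: xgetP => [B _ hB|]; first exact: hB.
    by have [B hB] := mean_op (bmf_ind mA) => /(_ B)[].
  rewrite meanE; apply/eqP; rewrite eq_complex; apply/andP; split; apply/eqP => /=.
    rewrite -[RHS]/(\int[@arc R]_(z in A) rho h z) Rintegral_mkcond.
    apply: eq_Rintegral => z _; rewrite patchE /ind indicE /rho.
    by case: (z \in A); case: '[_, _] => a b /=; rewrite ?mul1r !mul0r ?subr0.
  rewrite (@eq_Rintegral _ _ _ (arc R) setT (fun=> 0)); first by rewrite Rintegral_cst// mul0r.
  move=> z _; rewrite /ind; have := ger0_Im (w0 z h).
  by case: '[_, _] => a b /= ->; rewrite mulr0 mul0r addr0.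
have dfin h A : measurable A -> dens h A \is a fin_num.
  by move=> mA; apply: integrable_fin_num => //; exact: integrableS (rho_int h).
exists mun; split.
  move=> h; have [m mE] := dens_measure h; exists m => A mA.
  by rewrite mE munP//; split=> //; exact: dfin.
split=> //; first by apply: aeW => t; exact: w0.
move=> h A mA; rewrite /quad_measure munP//= fineK; last exact: dfin.
by apply/esym; exact: arc_integralE mA (rho_m h) (rho_ge0 h).
Qed.

End Density.

(** * The Bernstein-Szego density *)

Lemma bop_sumr (R : realType) (H : hilbertSpace R) (A : bop H) (I : Type)
    (s : seq I) (P : pred I) (F : I -> H) :
  A (\sum_(i <- s | P i) F i) = \sum_(i <- s | P i) A (F i).
Proof. exact: linear_sum. Qed.

Section BernsteinSzego.
Variables (R : realType) (H : hilbertSpace R).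
Variables (mu : set (circle R) -> bop H) (n : nat).
Hypothesis nt : nontrivial mu.
Local Notation a := (Phi_coef mu n).
Local Notation kappa := (kappaR mu n).
Local Notation w := (bs_density mu n).
Implicit Types (z : circle R) (h g x y : H).

Let Phi z : bop H := opoly n a (cval z).
Definition Phi_inv z : bop H := rinv (Phi z).

Lemma Phi_inv_approx : exists C r : R, [/\ 0 <= C, 0 <= r < 1 & forall z,
  [/\ Phi_inv z * Phi z = 1, Phi z * Phi_inv z = 1 &
    forall k x, nm (Phi_inv z x - upart n a (k * n.+1) (cval z) x) <= C * r ^+ k * nm x]].
Proof.
have [C [r [C0 r01 hV]]] := opoly_inverse (Phi_coef_n mu n) (@Phi_orth _ _ mu nt n)
  (kappaR_coercive nt n) (@toep_ge0 _ _ mu nt n.+1).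
exists C, r; split=> // z; have [V [VP PV hVk]] := hV _ (nm_cval z).
by rewrite /Phi_inv (rinvE PV VP).
Qed.

Lemma Phi_invl z : Phi_inv z * Phi z = 1.
Proof. by have [C [r [_ _ /(_ z)[]]]] := Phi_inv_approx. Qed.

Lemma Phi_invr z : Phi z * Phi_inv z = 1.
Proof. by have [C [r [_ _ /(_ z)[]]]] := Phi_inv_approx. Qed.

Let sq := opsqrt kappa.

Lemma opsqrtP (A : bop H) : coercive A -> posdef (opsqrt A) /\ opsqrt A * opsqrt A = A.
Proof.
move=> /coercive_sqrt[S hS]; rewrite /opsqrt.
by case: xgetP => [B _ //|/(_ S)]; case.
Qed.

Let sqV := rinvP (opsqrtP (kappaR_coercive nt n)).1.2.

Lemma phiR_invertible z : invertible (phiR mu n (cval z)).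
Proof.
have [s1 s2] := sqV; exists (sq * Phi_inv z); rewrite /phiR PhiRE -/(Phi z).
rewrite mulrA -[_ * rinv _ * sq]mulrA s2 mulr1 Phi_invr; split=> //.
by rewrite mulrA -[sq * _ * _]mulrA Phi_invl mulr1 s1.
Qed.

(** kappa^(-1/2) disappears between phi and its adjoint. *)
Lemma bs_densityE z : w z = adj (Phi_inv z) * kappa * Phi_inv z.
Proof.
have [s1 s2] := sqV; have [pd ss] := opsqrtP (kappaR_coercive nt n).
rewrite -/sq in pd ss s1 s2.
have sadj : adj sq = sq by apply: psd_selfadj; exact/coercive_posop/posdef_coercive.
have a1 : adj (rinv sq) * sq = 1 by rewrite -{2}sadj -adjM s1 adj1.
have a2 : sq * adj (rinv sq) = 1 by rewrite -{1}sadj -adjM s2 adj1.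
have p1 : adj (Phi z) * adj (Phi_inv z) = 1 by rewrite -adjM Phi_invl adj1.
have p2 : adj (Phi_inv z) * adj (Phi z) = 1 by rewrite -adjM Phi_invr adj1.
rewrite /bs_density /phiR PhiRE -/(Phi z) -/sq adjM -ss.
apply: rinvE.
  rewrite !mulrA -[_ * adj (Phi z) * _]mulrA p1 mulr1.
  rewrite -[_ * adj _ * sq]mulrA a1 mulr1 -[_ * rinv sq * sq]mulrA s2 mulr1.
  exact: Phi_invr.
rewrite !mulrA -[_ * Phi_inv z * Phi z]mulrA Phi_invl mulr1.
rewrite -[_ * sq * rinv sq]mulrA s1 mulr1 -[_ * sq * adj _]mulrA a2 mulr1.
exact: p2.
Qed.

Lemma dot_bs_density z h g : '[w z h, g] = '[kappa (Phi_inv z h), Phi_inv z g].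
Proof. by rewrite bs_densityE !bopM adjPl. Qed.

Lemma Phi_inv_bound : exists2 C : R, 0 <= C & forall z x, nm (Phi_inv z x) <= C * nm x.
Proof.
have [C [r [C0 _ hV]]] := Phi_inv_approx; exists C => // z x.
have [_ _ /(_ 0 x)] := hV z.
by rewrite mul0n /upart big_ord0 subr0 expr0 mulr1.
Qed.

Lemma bs_density_bound : exists2 M : R, 0 <= M & forall z h g,
  nm '[w z h, g] <= M * nm h * nm g.
Proof.
have [C C0 hC] := Phi_inv_bound.
exists (opb kappa * C * C) => [|z h g]; first by rewrite !mulr_ge0 ?opb_ge0.
rewrite dot_bs_density (le_trans (dot_bop_bound _ _ _))//.
have -> : opb kappa * C * C * nm h * nm g = opb kappa * (C * nm h) * (C * nm g) by ring.
apply: ler_pM; rewrite ?mulr_ge0 ?opb_ge0 ?nm_ge0//.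
by rewrite ler_wpM2l ?opb_ge0.
Qed.

Lemma bs_density_pos z : posop (w z).
Proof.
by move=> x; rewrite dot_bs_density; exact: (coercive_posop (kappaR_coercive nt n)).
Qed.

Lemma bs_density_coercive : exists2 d : R, 0 < d & forall z x,
  (d * nm x ^+ 2)%:C%C <= '[w z x, x].
Proof.
have [d d0 hd] := kappaR_coercive nt n.
pose L := \sum_(i < n.+1) opb (a i) + 1.
have L0 : 0 < L by rewrite ltr_wpDl// sumr_ge0// => *; exact: opb_ge0.
have PL z x : nm (Phi z x) <= L * nm x.
  rewrite /Phi /opoly bop_sum (le_trans (nm_sum _ _ _))// /L mulrDl mulr_suml.
  rewrite -[leLHS]addr0 lerD// ?mul1r ?nm_ge0//.
  by apply: ler_sum => i _; rewrite nmZ nmX nm_cval expr1n mul1r opbP.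
exists (d / L ^+ 2) => [|z x]; first by rewrite divr_gt0// exprn_gt0.
rewrite dot_bs_density; apply: le_trans (hd _); rewrite lecR -mulrA ler_wpM2l ?(ltW d0)//.
rewrite mulrC ler_pdivrMr ?exprn_gt0// -exprMn mulrC lerXn2r ?nnegrE ?nm_ge0//.
  by rewrite mulr_ge0 ?nm_ge0 ?ltW.
by have := PL z (Phi_inv z x); rewrite -bopM Phi_invr bop1.
Qed.

Lemma dot_upart y N z g :
  '[y, upart n a N (cval z) g] = \sum_(l < N) cval z ^ l%:Z * '[y, ucoef n a l g].
Proof.
rewrite /upart bop_sum dot_sumr; apply: eq_bigr => l _.
by rewrite dotZr exprnN conj_cvalX opprK.
Qed.

Lemma bmf_dot_upart y N g : bmf (fun z => '[y, upart n a N (cval z) g]).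
Proof.
rewrite (_ : (fun z => _) = fun z => \sum_(l < N) cval z ^ l%:Z * '[y, ucoef n a l g]).
  apply: (@bmf_sum _ _ _ (fun (l : 'I_N) z => cval z ^ l%:Z * '[y, ucoef n a l g])) => l.
  by apply: bmfM; [exact: bmf_cvalX|exact: bmf_cst].
by apply/funext => z; exact: dot_upart.
Qed.

Lemma bmf_dot_Phi_inv y g : bmf (fun z => '[y, Phi_inv z g]).
Proof.
have [C [r [C0 r01 hV]]] := Phi_inv_approx.
apply: (@bmf_lim _ (fun k z => '[y, upart n a (k * n.+1) (cval z) g]) _ (nm y * (C * nm g)) r) => //.
- by rewrite !mulr_ge0 ?nm_ge0.
- by move=> k; exact: bmf_dot_upart.
- move=> k z; rewrite -dotBr (le_trans (CauchySchwarz _ _))//.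
  by rewrite -!mulrA ler_wpM2l ?nm_ge0// [nm g * _]mulrC mulrA; have [_ _] := hV z.
Qed.

Lemma bs_density_weakly_measurable : weakly_measurable w.
Proof.
suff b h g : bmf (fun z => '[w z h, g]) by move=> h g; have [] := b h g.
have [C [r [C0 r01 hV]]] := Phi_inv_approx.
have [D D0 hD] := Phi_inv_bound; have /andP[r0 r1] := r01.
pose F k z : R[i] := '[kappa (upart n a (k * n.+1) (cval z) h), Phi_inv z g].
apply: (@bmf_lim _ F _ (opb kappa * (C * nm h) * (D * nm g)) r) => //.
- by do ?[apply: mulr_ge0]; rewrite ?opb_ge0 ?nm_ge0.
- move=> k; rewrite /F (_ : (fun z => _) = fun z =>
    \sum_(l < k * n.+1) cval z ^ (- l%:Z) * '[kappa (ucoef n a l h), Phi_inv z g]).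
    apply: (@bmf_sum _ _ _ (fun (l : 'I_(k * n.+1)) z =>
      cval z ^ (- l%:Z) * '[kappa (ucoef n a l h), Phi_inv z g])) => l.
    by apply: bmfM; [exact: bmf_cvalX|exact: bmf_dot_Phi_inv].
  apply/funext => z; rewrite /upart bop_sum bop_sumr dot_suml.
  by apply: eq_bigr => l _; rewrite bopZ bopZr dotZl exprnN.
- move=> k z; rewrite dot_bs_density /F -dotBl -bopBr.
  rewrite (le_trans (dot_bop_bound _ _ _))//.
  have -> : opb kappa * (C * nm h) * (D * nm g) * r ^+ k =
    opb kappa * (C * r ^+ k * nm h) * (D * nm g) by ring.
  apply: ler_pM; rewrite ?mulr_ge0 ?opb_ge0 ?nm_ge0//.
  by rewrite ler_wpM2l ?opb_ge0//; have [_ _] := hV z.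
Qed.

(** The expansion of Phi^-1 at infinity starts with z^-n, so that of its adjoint
    starts with z^n; the coefficients of the partial sums are exact and the
    remainders tend to 0. *)
Lemma mean_Phi_inv (k : int) y g : (k <= n%:Z)%R ->
  mean (fun z => cval z ^ (- k) * '[y, Phi_inv z g]) = if k == n%:Z then '[y, g] else 0.
Proof.
move=> kn; have [C [r [C0 r01 hV]]] := Phi_inv_approx.
have /andP[r0 r1] := r01.
have part N : mean (fun z => cval z ^ (- k) * '[y, upart n a (N.+1 * n.+1) (cval z) g]) =
    if k == n%:Z then '[y, g] else 0.
  rewrite (@eq_mean _ _ (fun z => \sum_(l < N.+1 * n.+1)
      '[y, ucoef n a l g] * cval z ^ (l%:Z - k))); last first.
    move=> z; rewrite dot_upart mulr_sumr; apply: eq_bigr => l _.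
    by rewrite mulrA mulrC -expfzDr ?cval_neq0// [- k + _]addrC.
  rewrite (@mean_sum _ _ _ (fun (l : 'I_(N.+1 * n.+1)) z =>
      '[y, ucoef n a l g] * cval z ^ (l%:Z - k))); last first.
    by move=> l; apply: bmfZ; exact: bmf_cvalX.
  have nN : (n < N.+1 * n.+1)%N by rewrite mulSn ltnS leq_addr.
  rewrite (bigD1 (Ordinal nN))//= big1 ?addr0 => [|l ln].
    rewrite meanZ ?mean_cvalX; last exact: bmf_cvalX.
    rewrite (ucoef_n n a) bop1 subr_eq0 eq_sym.
    by case: eqP => _; rewrite ?mulr1 ?mulr0.
  rewrite meanZ ?mean_cvalX; last exact: bmf_cvalX.
  have [lk|] := eqVneq (l%:Z - k) 0; last by rewrite mulr0.
  have ln' : (l < n)%N.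
    rewrite ltn_neqAle; apply/andP; split; first exact: ln.
    by rewrite -lez_nat; move/eqP: lk; rewrite subr_eq0 => /eqP ->.
  by rewrite ucoef_lt// bop0 dot0r mul0r.
have [D [D0 hD]] : exists D : R, 0 <= D /\ forall N,
    nm (mean (fun z => cval z ^ (- k) * '[y, Phi_inv z g]) -
        (if k == n%:Z then '[y, g] else 0)) <= D * r ^+ N.
  exists (2 * (nm y * (C * nm g))); split; first by rewrite !mulr_ge0 ?nm_ge0.
  move=> N; rewrite -(part N) -meanB; last 2 first.
  - by apply: bmfM; [exact: bmf_cvalX|exact: bmf_dot_Phi_inv].
  - by apply: bmfM; [exact: bmf_cvalX|exact: bmf_dot_upart].
  rewrite -mulrA; apply: mean_bound.
    apply: bmfB; apply: bmfM; try exact: bmf_cvalX.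
      exact: bmf_dot_Phi_inv.
    exact: bmf_dot_upart.
  move=> z; rewrite -mulrBr -dotBr nmM nm_cvalX mul1r (le_trans (CauchySchwarz _ _))//.
  rewrite -mulrA ler_wpM2l ?nm_ge0//; have [_ _ h] := hV z.
  rewrite (le_trans (h N.+1 g))// exprS.
  have -> : C * (r * r ^+ N) * nm g = r * (C * nm g * r ^+ N) by ring.
  by rewrite ler_piMl// ?(ltW r1)// mulr_ge0 ?exprn_ge0// mulr_ge0 ?nm_ge0.
apply/eqP; rewrite -subr_eq0; apply/eqP/nm_eq0/eqP.
rewrite eq_le nm_ge0 andbT; apply: le_eps => e e0; rewrite add0r.
have [N hN] := geometric_small D0 r01 e0.
exact: le_trans (hD N) (ltW (hN _ (leqnn _))).
Qed.

Section Measure.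
Variable mun : set (circle R) -> bop H.
Hypotheses (mun_povm : is_povm mun) (mun_d : has_density mun w).
Local Notation c := (moment mun).

Lemma bs_moment j h g : '[c j h, g] = mean (fun z => cval z ^ (- j) * '[w z h, g]).
Proof.
have [M M0 wM] := bs_density_bound.
exact: (moment_density M0 wM bs_density_weakly_measurable bs_density_pos mun_povm mun_d).
Qed.

Lemma bs_bmf h g : bmf (fun z => '[w z h, g]).
Proof.
have [M M0 wM] := bs_density_bound.
exact: (density_bmf wM bs_density_weakly_measurable).
Qed.

(** w Phi = (Phi^-1)^* kappa, read in Fourier coefficients; negative k are
    included. *)
Lemma bs_orth (k : int) : k <= n%:Z ->
  \sum_(i < n.+1) c (k - i%:Z) * a i = if k == n%:Z then kappa else 0.
Proof.
move=> kn; apply: bop_injl => h g.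
transitivity (mean (fun z => cval z ^ (- k) * '[kappa h, Phi_inv z g])); last first.
  by rewrite mean_Phi_inv//; case: eqP => // _; rewrite bop0 dot0l.
rewrite bop_sum dot_suml.
pose F (i : 'I_n.+1) z := cval z ^ (- (k - i%:Z)) * '[w z (a i h), g].
have -> : mean (fun z => cval z ^ (- k) * '[kappa h, Phi_inv z g]) = mean (fun z => \sum_i F i z).
  apply: eq_mean => z; have -> : kappa h = kappa (Phi_inv z (Phi z h)).
    by rewrite -[Phi_inv z _]bopM Phi_invl.
  rewrite -dot_bs_density /Phi /opoly bop_sum bop_sumr dot_suml mulr_sumr.
  apply: eq_bigr => i _; rewrite /F bopZ bopZr dotZl mulrA; congr (_ * _).
  by rewrite opprB addrC expfzDr ?cval_neq0.
rewrite mean_sum => [|i]; last by apply: bmfM; [exact: bmf_cvalX|exact: bs_bmf].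
by apply: eq_bigr => i _; rewrite bs_moment.
Qed.

(** The form is the mean of <w P, P> with P(z) = sum_k z^(e k) f_k, while the
    mean of |P|^2 is the sum of the |f_k|^2. The exponents e cover T^R (e k = k)
    and T^L (e k = - k). *)
Lemma bs_form_coercive : exists2 d : R, 0 < d &
  forall N (e : nat -> int) (f : nat -> H), injective e ->
  (d * \sum_(i < N) nm (f i) ^+ 2)%:C%C <=
    \sum_(j < N) \sum_(k < N) '[c (e j - e k) (f k), f j].
Proof.
have [d d0 hd] := bs_density_coercive; exists d => // N e f ei.
pose P z : H := \sum_(k < N) cval z ^ (e k) *: f k.
have expand (G : circle R -> bop H) z : '[G z (P z), P z] =
    \sum_(j < N) \sum_(k < N) cval z ^ (- (e j - e k)) * '[G z (f k), f j].
  rewrite {2}/P dot_sumr; apply: eq_bigr => j _.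
  rewrite /P bop_sumr dot_suml; apply: eq_bigr => k _.
  rewrite dotZr bopZr dotZl conj_cvalX mulrA -expfzDr ?cval_neq0//.
  by rewrite opprB addrC.
have EG (G : circle R -> bop H) : (forall h g, bmf (fun z => '[G z h, g])) ->
    bmf (fun z => '[G z (P z), P z]) /\ mean (fun z => '[G z (P z), P z]) =
    \sum_(j < N) \sum_(k < N) mean (fun z => cval z ^ (- (e j - e k)) * '[G z (f k), f j]).
  move=> bG; pose F j k z := cval z ^ (- (e j - e k)) * '[G z (f k), f j].
  have bF j k : bmf (F j k) by apply: bmfM; [exact: bmf_cvalX|exact: bG].
  have bS (j : 'I_N) : bmf (fun z => \sum_(k < N) F j k z).
    by apply: (@bmf_sum _ _ _ (fun (k : 'I_N) z => F j k z)).
  have eF : (fun z => '[G z (P z), P z]) = fun z => \sum_(j < N) \sum_(k < N) F j k z.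
    by apply/funext => z; exact: expand.
  rewrite eF; split; first exact: (@bmf_sum _ _ _ (fun (j : 'I_N) z => \sum_(k < N) F j k z)).
  rewrite (@mean_sum _ _ _ (fun (j : 'I_N) z => \sum_(k < N) F j k z))//.
  by apply: eq_bigr => j _; rewrite (@mean_sum _ _ _ (fun (k : 'I_N) z => F j k z)).
have [bw Ew] := EG w bs_bmf.
have [b1 E1] := EG (fun=> 1) (fun h g => bmf_cst _).
have -> : \sum_(j < N) \sum_(k < N) '[c (e j - e k) (f k), f j] =
    mean (fun z => '[w z (P z), P z]).
  by rewrite Ew; apply: eq_bigr => j _; apply: eq_bigr => k _; rewrite bs_moment.
have -> : (d * \sum_(i < N) nm (f i) ^+ 2)%:C%C =
    mean (fun z => d%:C%C * '[(1 : bop H) (P z), P z]).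
  rewrite meanZ// E1 rmorphM/= rmorph_sum; congr (_ * _); apply: eq_bigr => j _ /=.
  rewrite (bigD1 j)//= big1 => [|k kj].
    rewrite subrr oppr0 -dotxx addr0 -[LHS]mean_cst.
    by apply: eq_mean => z; rewrite expr0z mul1r.
  rewrite (@eq_mean _ _ (fun z => '[f k, f j] * cval z ^ (- (e j - e k)))); last first.
    by move=> z; rewrite mulrC.
  rewrite meanZ ?mean_cvalX; last exact: bmf_cvalX.
  rewrite ifN ?mulr0// oppr_eq0 subr_eq0; apply: contra kj => /eqP/ei/ord_inj ->.
  by [].
rewrite -subr_ge0 -meanB//; last exact: bmfZ.
apply: mean_ge0 => z; rewrite subr_ge0; apply: le_trans (hd z _).
by rewrite bop1 dotxx -rmorphM.
Qed.

End Measure.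
End BernsteinSzego.

(** * Coercive operator matrices *)

Section OperatorMatrices.
Variables (R : realType) (H : hilbertSpace R).

Definition mxact p q (T : 'M[bop H]_(p, q)) (f : 'I_q -> H) (j : 'I_p) : H :=
  \sum_k T j k (f k).

Lemma mxactM p q r (S : 'M[bop H]_(p, q)) (T : 'M[bop H]_(q, r)) f j :
  mxact (S *m T) f j = mxact S (mxact T f) j.
Proof.
rewrite /mxact; under [RHS]eq_bigr do rewrite bop_sumr.
rewrite exchange_big; apply: eq_bigr => k _; rewrite mxE bop_sum.
by apply: eq_bigr => i _.
Qed.

(** Schur complement formula over a noncommutative ring. *)
Lemma block_invertible p q (A : 'M[bop H]_p) (B : 'M[bop H]_(p, q))
    (C : 'M[bop H]_(q, p)) (D Di : 'M[bop H]_q) (s' : 'M[bop H]_p) : D *m Di = 1%:M -> Di *m D = 1%:M ->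
  (A - B *m Di *m C) *m s' = 1%:M -> s' *m (A - B *m Di *m C) = 1%:M ->
  exists S, block_mx A B C D *m S = 1%:M /\ S *m block_mx A B C D = 1%:M.
Proof.
move=> DDi DiD; set s := A - _ => ss' s's.
exists (block_mx s' (- (s' *m B *m Di)) (- (Di *m C *m s'))
  (Di + Di *m C *m s' *m B *m Di)).
rewrite !mulmx_block scalar_mx_block.
have As : A = s + B *m Di *m C by rewrite subrK.
split; congr block_mx.
- by rewrite mulmxN !mulmxA -mulmxBl.
- rewrite mulmxN mulmxDr !mulmxA As mulmxDl ss' !mulmxDl mul1mx opprD.
  by rewrite -addrA [X in _ + X]addrCA addKr addNr.
- by rewrite mulmxN !mulmxA DDi mul1mx subrr.
- by rewrite mulmxN mulmxDr !mulmxA DDi mul1mx addrCA addrC addNr add0r.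
- by rewrite mulNmx -!mulmxA -mulmxBr !mulmxA.
- by rewrite mulNmx -[_ *m Di *m D]mulmxA DiD mulmx1 subrr.
- have e : Di *m C *m s' *m B *m Di *m C = Di *m C *m s' *m A - Di *m C.
    rewrite -[X in _ = _ - X]mulmx1 -s's mulmxA -mulmxBr -!mulmxA.
    by do 3 congr (_ *m _); rewrite /s opprB [RHS]addrC subrK mulmxA.
  by rewrite mulNmx mulmxDl e [X in _ + X]addrCA subrr addr0 addNr.
- by rewrite mulNmx mulmxDl -[_ *m Di *m D]mulmxA DiD mulmx1 addrCA addNr addr0.
Qed.

Definition mxform p (T : 'M[bop H]_p) (f : 'I_p -> H) : R[i] :=
  \sum_j '[mxact T f j, f j].

(** Induction on the size. The lower right block inherits coercivity, and so does
    its Schur complement s: the form of s at x is that of T at the vector with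
    head x whose tail makes the last p components of its image vanish. *)
Lemma coercive_mx_invertible p (T : 'M[bop H]_p) (d : R) : 0 < d ->
  (forall f, (d * \sum_i nm (f i) ^+ 2)%:C%C <= mxform T f) -> invertible T.
Proof.
move=> d0; elim: p T => [|p IH] T hT.
  by exists 0; split; apply/matrixP => -[].
pose T' : 'M[bop H]_(1 + p) := T.
have TE : T = block_mx (ulsubmx T') (ursubmx T') (dlsubmx T') (drsubmx T').
  by rewrite submxK.
set A := ulsubmx T' in TE; set B := ursubmx T' in TE.
set C := dlsubmx T' in TE; set D := drsubmx T' in TE.
pose glue (x : H) (f : 'I_p -> H) (i : 'I_p.+1) : H :=
  if unlift ord0 i is Some k then f k else x.
have glue0 x f : glue x f ord0 = x by rewrite /glue unlift_none.
have glueS x f k : glue x f (lift ord0 k) = f k by rewrite /glue liftK.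
have l0 (k : 'I_1) : lshift p k = ord0 by apply: val_inj; rewrite /= ord1.
have rS (k : 'I_p) : rshift 1 k = lift ord0 k by apply: val_inj.
have AE : A ord0 ord0 = T ord0 ord0 by rewrite !mxE !l0.
have BE k : B ord0 k = T ord0 (lift ord0 k) by rewrite !mxE !l0 rS.
have CE k : C k ord0 = T (lift ord0 k) ord0 by rewrite !mxE !l0 rS.
have DE j k : D j k = T (lift ord0 j) (lift ord0 k) by rewrite !mxE !rS.
have formE x f : mxform T (glue x f) =
    '[A ord0 ord0 x + mxact B f ord0, x] +
    \sum_j '[C j ord0 x + mxact D f j, f j].
  rewrite /mxform big_ord_recl glue0; congr ('[_, _] + _).
    rewrite /mxact big_ord_recl glue0 AE; congr (_ + _).
    by apply: eq_bigr => k _; rewrite glueS BE.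
  apply: eq_bigr => j _; rewrite glueS; congr ('[_, _]).
  rewrite /mxact big_ord_recl glue0 CE; congr (_ + _).
  by apply: eq_bigr => k _; rewrite glueS DE.
have sumE x f : \sum_i nm (glue x f i) ^+ 2 = nm x ^+ 2 + \sum_i nm (f i) ^+ 2.
  by rewrite big_ord_recl glue0; congr (_ + _); apply: eq_bigr => i _; rewrite glueS.
have [Di [DDi DiD]] : exists Di, D *m Di = 1%:M /\ Di *m D = 1%:M.
  apply: (IH D) => f; have := hT (glue 0 f).
  rewrite formE sumE nm0 expr0n add0r dot0r add0r.
  have -> // : \sum_j '[C j ord0 0 + mxact D f j, f j] = mxform D f.
  by apply: eq_bigr => j _; rewrite bopr0 add0r.
pose s := A - B *m Di *m C.
have sE x : s ord0 ord0 x = A ord0 ord0 x - mxact B (mxact (Di *m C) (fun=> x)) ord0.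
  rewrite /s mxE [X in A _ _ + X]mxE bopB; congr (_ - _).
  by rewrite -mxactM mulmxA /mxact big_ord1.
have [s1 [ss1 s1s]] : invertible (s ord0 ord0).
  apply: coercive_invertible; exists d => // x.
  pose f := fun j => - mxact (Di *m C) (fun _ : 'I_1 => x) j.
  have mN q (M : 'M[bop H]_(q, p)) j : mxact M f j = - mxact M (mxact (Di *m C) (fun=> x)) j.
    by rewrite /mxact -sumrN; apply: eq_bigr => k _; rewrite /f -scaleN1r bopZr scaleN1r.
  have tail0 : \sum_j '[C j ord0 x + mxact D f j, f j] = 0.
    apply: big1 => j _; rewrite mN -mxactM mulmxA DDi mul1mx.
    by rewrite [mxact C _ _]big_ord1 subrr dot0l.
  have := hT (glue x f); rewrite formE sumE mN -sE tail0 addr0.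
  apply: le_trans; rewrite lecR ler_wpM2l ?(ltW d0)// lerDl.
  by apply: sumr_ge0 => i _; exact: sqr_ge0.
have [||S [TS ST]] := @block_invertible 1 p A B C D Di (const_mx s1) DDi DiD.
- by apply/matrixP => i j; rewrite !ord1 mxE big_ord1 [const_mx s1 _ _]mxE -/s [RHS]mxE; exact: ss1.
- by apply/matrixP => i j; rewrite !ord1 mxE big_ord1 [const_mx s1 _ _]mxE -/s [RHS]mxE; exact: s1s.
by exists S; rewrite TE.
Qed.

End OperatorMatrices.

(** * The orthogonal polynomials of the Bernstein-Szego measure *)

Section Final.
Variables (R : realType) (H : hilbertSpace R).
Variables (mu : set (circle R) -> bop H) (n : nat).
Hypothesis nt : nontrivial mu.
Local Notation a := (Phi_coef mu n).
Local Notation kappa := (kappaR mu n).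
Local Notation w := (bs_density mu n).

Variable mun : set (circle R) -> bop H.
Hypotheses (mun_povm : is_povm mun) (mun_d : has_density mun w).
Local Notation c := (moment mun).

Let formP N (e : nat -> int) : injective e ->
  posdef_mx (\matrix_(j < N, k < N) c (e j - e k)).
Proof.
move=> ei; have [d d0 hd] := bs_form_coercive nt mun_povm mun_d.
set T := \matrix_(_, _) _.
have hT (f : 'I_N -> H) : (d * \sum_i nm (f i) ^+ 2)%:C%C <= mxform T f.
  pose f' i : H := if insub i is Some k then f k else 0.
  have f'E (i : 'I_N) : f' i = f i by rewrite /f' valK.
  have := hd N e f' ei.
  under eq_bigr do rewrite f'E.
  rewrite /mxform (eq_bigr (fun j => '[mxact T f j, f j])) // => j _.
  rewrite f'E /mxact dot_suml; apply: eq_bigr => k _.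
  by rewrite f'E mxE.
split; last exact: (coercive_mx_invertible d0 hT).
move=> x x0; apply: lt_le_trans (hT x).
rewrite ltcR mulr_gt0// lt_neqAle eq_sym; apply/andP; split; last first.
  by apply: sumr_ge0 => i _; exact: sqr_ge0.
apply: contra x0 => /eqP s0; apply/eqP/ffunP => i; rewrite ffunE.
have /eqP : nm (x i) ^+ 2 = 0.
  by apply: (psumr_eq0P _ s0) => // k _; exact: sqr_ge0.
by rewrite sqrf_eq0 => /eqP/nm_eq0.
Qed.

(** T^L is the form of [bs_form_coercive] for decreasing exponents. *)
Lemma bs_nontrivial : nontrivial mun.
Proof.
move=> N _; split.
  exact: (@formP N (fun k => k%:Z)) (fun x y => @congr1 _ _ absz _ _).
have -> : toepL mun N = \matrix_(j < N, k < N) c (- j%:Z - - k%:Z).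
  by apply/matrixP => j k; rewrite !mxE opprK addrC.
by apply: (@formP N (fun k => - k%:Z)) => x y /oppr_inj [].
Qed.

Lemma bs_moment_eq j : (`|j| <= n)%N -> c j = moment mu j.
Proof.
apply: (orth_tform_unique (Phi_coef_n mu n) _ (@Phi_orth _ _ mu nt n)
  (kappaR_coercive nt n)).
- by move=> k kn; rewrite (bs_orth nt mun_povm mun_d).
- by move=> f; exact: (toep_ge0 bs_nontrivial).
- by move=> f; exact: (toep_ge0 nt).
Qed.

Lemma bs_toepR j : (j <= n)%N -> toepR mun j = toepR mu j.
Proof.
move=> jn; apply/matrixP => i k; rewrite !mxE; apply: bs_moment_eq.
have := ltn_ord i; have := ltn_ord k; lia.
Qed.

Lemma bs_toepL j : (j <= n)%N -> toepL mun j = toepL mu j.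
Proof.
move=> jn; apply/matrixP => i k; rewrite !mxE; apply: bs_moment_eq.
have := ltn_ord i; have := ltn_ord k; lia.
Qed.

Lemma bs_nuv j : (j <= n)%N -> nuv mun j = nuv mu j.
Proof.
move=> jn; apply/matrixP => i k; rewrite !mxE; apply: bs_moment_eq.
have := ltn_ord i; lia.
Qed.

Lemma bs_xiv j : (j <= n)%N -> xiv mun j = xiv mu j.
Proof.
move=> jn; apply/matrixP => i k; rewrite !mxE; apply: bs_moment_eq.
have := ltn_ord i; lia.
Qed.

Lemma bs_PhiR_le j z : (j <= n)%N -> PhiR mun j z = PhiR mu j z.
Proof. by move=> jn; rewrite /PhiR bs_toepR// bs_nuv. Qed.

Lemma bs_kappaR_le j : (j <= n)%N -> kappaR mun j = kappaR mu j.
Proof. by move=> jn; rewrite /kappaR bs_toepR// bs_nuv// bs_moment_eq. Qed.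

Lemma bs_kappaL_le j : (j <= n)%N -> kappaL mun j = kappaL mu j.
Proof. by move=> jn; rewrite /kappaL bs_toepL// bs_xiv// bs_moment_eq. Qed.

(** Coefficients of z^d Phi_n. *)
Let b d i : bop H := if (i < d)%N then 0 else a (i - d).

Let sum_b d (F : nat -> bop H -> bop H) : (forall i, F i 0 = 0) ->
  \sum_(i < (d + n).+1) F i (b d i) = \sum_(i < n.+1) F (d + i)%N (a i).
Proof.
move=> F0; rewrite -addnS big_split_ord/= big1 ?add0r => [|i _]; last first.
  by rewrite /b ltn_ord F0.
by apply: eq_bigr => i _; rewrite /b ltnNge leq_addr/= addKn.
Qed.

(** z^d Phi satisfies relation (1) in degree d + n, because [bs_orth] extends to
    negative indices. *)
Let b_orth d (k : nat) : (k <= d + n)%N ->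
  \sum_(i < (d + n).+1) c (k%:Z - i%:Z) * b d i = if k == (d + n)%N then kappa else 0.
Proof.
move=> kd; rewrite (@sum_b d (fun i A => c (k%:Z - i%:Z) * A)); last by move=> i; rewrite mulr0.
rewrite (eq_bigr (fun i : 'I_n.+1 => c ((k%:Z - d%:Z) - i%:Z) * a i)); last first.
  by move=> i _; rewrite PoszD opprD addrA.
rewrite (bs_orth nt mun_povm mun_d); last by lia.
by congr (if _ then _ else _); lia.
Qed.

Lemma bs_Phi_coef d i : (i <= d + n)%N -> Phi_coef mun (d + n) i = b d i.
Proof.
have bn : b d (d + n) = 1 by rewrite /b ltnNge leq_addr/= addKn Phi_coef_n.
rewrite leq_eqVlt => /orP[/eqP ->|id]; first by rewrite Phi_coef_n bn.
rewrite -[i in LHS]/(nat_of_ord (Ordinal id)) Phi_coef_lt.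
set j := (d + n)%N in id bn *; have [_ ST] := toepRV bs_nontrivial j.
pose B : 'cV[bop H]_j := \col_k b d k.
have TB : toepR mun j *m B = - nuv mun j.
  apply/matrixP => k l; rewrite !mxE.
  have := b_orth (ltnW (ltn_ord k)); rewrite big_ord_recr/= -/j bn mulr1 ltn_eqF//.
  move=> /eqP; rewrite addr_eq0 => /eqP <-.
  by apply: eq_bigr => q _; rewrite !mxE.
have -> : nuv mun j = - (toepR mun j *m B) by rewrite TB opprK.
by rewrite mulmxN mulmxA ST mul1mx !mxE opprK.
Qed.

Lemma bs_PhiR_ge d z : PhiR mun (d + n) z = z ^+ d *: PhiR mu n z.
Proof.
rewrite !PhiRE /opoly (eq_bigr (fun i : 'I_(d + n).+1 => z ^+ i *: b d i)); last first.
  by move=> i _; rewrite bs_Phi_coef// -ltnS.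
rewrite (@sum_b d (fun i A => z ^+ i *: A)); last by move=> i; rewrite scaler0.
by rewrite scaler_sumr; apply: eq_bigr => i _; rewrite scalerA exprD.
Qed.

Lemma bs_kappaR_ge d : kappaR mun (d + n) = kappa.
Proof.
have := b_orth (leqnn (d + n)); rewrite eqxx => <-.
have := @Phi_orth _ _ mun bs_nontrivial (d + n) _ (leqnn _); rewrite eqxx => <-.
by apply: eq_bigr => i _; rewrite bs_Phi_coef// -ltnS.
Qed.

Lemma bs_phiR_ge j z : (n <= j)%N -> phiR mun j z = z ^+ (j - n) *: phiR mu n z.
Proof.
move=> nj; rewrite -{1}(subnK nj) /phiR bs_PhiR_ge bs_kappaR_ge.
by apply: bop_ext => x.
Qed.

Lemma bs_verblunsky_ge j : (n <= j)%N -> verblunsky mun j = 0.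
Proof.
move=> nj; rewrite /verblunsky -{2}(subnK nj) -addSn bs_PhiR_ge.
by rewrite expr0n/= scale0r adj0 mulr0 mul0r oppr0.
Qed.

Lemma bs_verblunsky_lt j : (j < n)%N -> verblunsky mun j = verblunsky mu j.
Proof.
by move=> jn; rewrite /verblunsky bs_PhiR_le// bs_kappaR_le ?bs_kappaL_le// ltnW.
Qed.

End Final.

Theorem theorem6p2 (R : realType) (H : hilbertSpace R)
  (mu : set (circle R) -> bop H)
  (mu_povm : is_povm mu) (mu_ac : abs_continuous mu)
  (mu_nontrivial : nontrivial mu) (mu_0 : moment mu 0 = 1) (n : nat) :
  (* the density makes sense, and the measure mu^(n) exists *)
  (forall z : circle R, invertible (phiR mu n (cval z))) /\
  (exists mun : set (circle R) -> bop H,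
     is_povm mun /\ has_density mun (bs_density mu n)) /\
  (forall mun : set (circle R) -> bop H,
     is_povm mun -> has_density mun (bs_density mu n) ->
     nontrivial mun /\
     mun setT = 1 /\
     (forall j (z : R[i]), (j <= n)%N -> phiR mun j z = phiR mu j z) /\
     (forall j (z : R[i]), (n < j)%N ->
        phiR mun j z = z ^+ (j - n) *: phiR mu n z) /\
     (forall j, (j < n)%N -> verblunsky mun j = verblunsky mu j) /\
     (forall j, (n <= j)%N -> verblunsky mun j = 0)).
Proof.
have nt := mu_nontrivial.
split; first exact: phiR_invertible.
have [M M0 wM] := bs_density_bound n nt.
have wm := bs_density_weakly_measurable n nt.
have w0 := bs_density_pos n nt.
split; first exact: (povm_of_density M0 wM wm w0).
move=> mun mun_povm mun_d; split; first exact: (bs_nontrivial nt mun_povm mun_d).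
split.
  rewrite (povm_total_density M0 wM wm w0 mun_povm mun_d).
  by rewrite (bs_moment_eq nt mun_povm mun_d) ?mu_0.
split.
  move=> j z jn; rewrite /phiR (bs_PhiR_le nt mun_povm mun_d _ jn).
  by rewrite (bs_kappaR_le nt mun_povm mun_d jn).
split; first by move=> j z /ltnW; exact: (bs_phiR_ge nt mun_povm mun_d).
split; first exact: (bs_verblunsky_lt nt mun_povm mun_d).
exact: (bs_verblunsky_ge nt mun_povm mun_d).
Qed.
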